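(* Let $\mathbf n=(n_1,\dots,n_r)$ with $r\ge1$ and $n_i\ge1$ for all $i$, and let $R:=\{i\in[r]: n_i\ge2\}$. If $0\le k\le\sum_{i\in R}\big\lfloor\frac{n_i-2}{2}\big\rfloor$, then $\delta_{pr}(k,\mathbf n)\ge 2k+|R|+1$.
   Context: $\Delta_m$ denotes the $m$-dimensional simplex; for $\mathbf n=(n_1,\dots,n_r)$, $\Delta_{\mathbf n}:=\Delta_{n_1}\times\dots\times\Delta_{n_r}$. The $k$-skeleton of a polytope is the poset of its faces of dimension at most $k$; two $k$-skeleta are combinatorially equivalent if these posets are isomorphic. A convex polytope is $(k,\mathbf n)$-PSN if its $k$-skeleton is combinatorially equivalent to that of $\Delta_{\mathbf n}$, and $(k,\mathbf n)$-PPSN if in addition it is the image under a linear projection of a polytope combinatorially equivalent to $\Delta_{\mathbf n}$. $\delta_{pr}(k,\mathbf n)$ is the smallest dimension of a $(k,\mathbf n)$-PPSN polytope. *)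

(* Defs.v *)
From HB Require Import structures.
From mathcomp Require Import all_boot all_order all_algebra.
Set Implicit Arguments. Unset Strict Implicit. Unset Printing Implicit Defensive.
Import Order.TTheory GRing.Theory Num.Theory.
Local Open Scope ring_scope.

Section PolytopeDefs.
Variable R : realFieldType.

Definition dotv (d : nat) (x c : 'rV[R]_d) : R := \sum_(j < d) x 0 j * c 0 j.

Definition conv (d : nat) (S : seq 'rV[R]_d) (x : 'rV[R]_d) : Prop :=
  exists w : 'I_(size S) -> R,
    [/\ forall i, 0 <= w i, \sum_(i < size S) w i = 1
      & x = \sum_(i < size S) w i *: nth 0 S i].

Definition polytope (d : nat) (P : 'rV[R]_d -> Prop) : Prop :=
  exists S : seq 'rV[R]_d, forall x, P x <-> conv S x.

(* F is a face of P: intersection of P with a supporting hyperplane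
   (c = 0, b = 0 gives P itself; c = 0, b = 1 gives the empty face) *)
Definition face (d : nat) (P F : 'rV[R]_d -> Prop) : Prop :=
  exists (c : 'rV[R]_d) (b : R),
    (forall x, P x -> dotv x c <= b) /\ (forall x, F x <-> (P x /\ dotv x c = b)).

Definition aff_indep (d m : nat) (p : 'I_m.+1 -> 'rV[R]_d) : bool :=
  row_free (\matrix_(i < m) (p (lift ord0 i) - p ord0)).

(* (affine) dimension of F is at most m  (the empty set has dimension -1):
   F contains no m+2 affinely independent points *)
Definition dim_le (d : nat) (F : 'rV[R]_d -> Prop) (m : nat) : Prop :=
  forall p : 'I_m.+2 -> 'rV[R]_d, (forall i, F (p i)) -> ~~ aff_indep p.

Definition subset_of (d : nat) (F G : 'rV[R]_d -> Prop) : Prop :=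
  forall x, F x -> G x.

(* isomorphism of posets (ordered by inclusion) of families of subsets,
   where subsets are identified up to extensional equality *)
Definition poset_iso (d e : nat) (A : ('rV[R]_d -> Prop) -> Prop)
    (B : ('rV[R]_e -> Prop) -> Prop) : Prop :=
  exists f : ('rV[R]_d -> Prop) -> ('rV[R]_e -> Prop),
    [/\ forall F, A F -> B (f F),
        forall G, B G -> exists F, A F /\ (forall y, f F y <-> G y)
      & forall F1 F2, A F1 -> A F2 ->
          (subset_of F1 F2 <-> subset_of (f F1) (f F2))].

Definition skeleton (d : nat) (P : 'rV[R]_d -> Prop) (k : nat)
    (F : 'rV[R]_d -> Prop) : Prop := face P F /\ dim_le F k.

Definition skel_equiv (d e : nat) (k : nat) (P : 'rV[R]_d -> Prop)
    (Q : 'rV[R]_e -> Prop) : Prop := poset_iso (skeleton P k) (skeleton Q k).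

Definition comb_equiv (d e : nat) (P : 'rV[R]_d -> Prop)
    (Q : 'rV[R]_e -> Prop) : Prop := poset_iso (face P) (face Q).

(* The product of simplices Delta_{n_1} x ... x Delta_{n_r}, realized in
   R^(r*N) = matrices 'M_(r,N) (via vec_mx), N = max (n_i + 1):
   row i is a point of the standard simplex conv(e_0,...,e_{n_i}). *)
Definition Nmax (r : nat) (n : 'I_r -> nat) : nat := \max_(i < r) (n i).+1.

Definition Delta (r : nat) (n : 'I_r -> nat) (x : 'rV[R]_(r * Nmax n)) : Prop :=
  let M := vec_mx x in
  [/\ forall i j, 0 <= M i j,
      forall i (j : 'I_(Nmax n)), (n i < j)%N -> M i j = 0
    & forall i, \sum_(j < Nmax n) M i j = 1].

Definition PSN (d : nat) (k r : nat) (n : 'I_r -> nat) (P : 'rV[R]_d -> Prop)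
  : Prop := polytope P /\ skel_equiv k P (@Delta r n).

Definition PPSN (d : nat) (k r : nat) (n : 'I_r -> nat) (P : 'rV[R]_d -> Prop)
  : Prop :=
  PSN k n P /\
  exists (e : nat) (Q : 'rV[R]_e -> Prop) (A : 'M[R]_(e, d)),
    [/\ polytope Q, comb_equiv Q (@Delta r n)
      & forall y, P y <-> exists x, Q x /\ y = x *m A].

End PolytopeDefs.

(* Main.v *)
Require Import Defs.
From HB Require Import structures.
From mathcomp Require Import all_boot all_order all_algebra.
From mathcomp Require Import zify lra ring.
From Stdlib Require Import Classical.
Set Implicit Arguments. Unset Strict Implicit. Unset Printing Implicit Defensive.
Import Order.TTheory GRing.Theory Num.Theory.

(* The facets of a polytope combinatorially equivalent to a product of simplices
   are indexed by the pairs (i, j) with j <= n i. For a direction y in the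
   kernel of the projection, record the rates at which y crosses the facets.
   A face S_1 x ... x S_r of dimension <= k is preserved by the projection, and
   the functional exposing its image is a combination of the facet functionals,
   positive exactly on the facets containing the face; so rates that are <= 0
   off S vanish off S. It thus suffices to find y <> 0 whose positive rates lie
   in some S of dimension <= k. In a small enough dimension of the image, this
   is an instance of the discrete ham sandwich theorem: r blocks of an odd
   number of vectors of an r-dimensional space are bisected by an affine
   hyperplane.

   Over an ordered field the ham sandwich theorem is proved by parity. For
   vectors in general position, call a transversal (one vector per block)
   balanced at level m when the functional of degree m vanishing on its first m
   vectors bisects the first m blocks. The number of balanced transversals is
   odd at every level: rotating in the pencil of functionals of degree m + 1
   vanishing on m vectors, the sign of the majority in block m is reversed, and
   it is so by crossing vectors of block m (which are the balanced transversals
   of level m + 1) or vectors of earlier blocks (which cancel in pairs). The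
   general case follows by perturbation towards the moment curve. *)

(** * Boxes in a product of finite sets *)

Section Boxes.
Variables (I T : finType) (D : I -> {set T}).

Notation box := {ffun I -> {set T}}.
Notation vert := {ffun I -> T}.

Implicit Types (S U E : box) (v w u : vert) (p q : I * T).

(** Boxes encode the nonempty faces of a product of simplices: [D i] is the vertex set of the [i]-th
    factor, and the face is the product of the simplices spanned by the [S i]. *)
Definition is_box (S : box) := [forall i, (S i != set0) && (S i \subset D i)].

Definition box_le (S S' : box) := [forall i, S i \subset S' i].

Definition box_dim (S : box) := \sum_i #|S i|.-1.

Definition full_box : box := [ffun i => D i].

Definition point_box (v : vert) : box := [ffun i => [set v i]].

Lemma box_leP S S' : reflect (forall i j, j \in S i -> j \in S' i) (box_le S S').
Proof.
apply: (iffP forallP) => H i; first by apply/subsetP/H.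
by apply/subsetP/H.
Qed.

Lemma box_le_refl S : box_le S S.
Proof. by apply/box_leP. Qed.

Lemma box_le_trans S1 S2 S3 : box_le S1 S2 -> box_le S2 S3 -> box_le S1 S3.
Proof. by move=> /box_leP H1 /box_leP H2; apply/box_leP => i j /H1/H2. Qed.

Lemma box_le_anti S S' : box_le S S' -> box_le S' S -> S = S'.
Proof.
move=> /box_leP H1 /box_leP H2; apply/ffunP => i; apply/setP => j.
by apply/idP/idP; [apply: H1|apply: H2].
Qed.

Lemma point_box_le v S : box_le (point_box v) S = [forall i, v i \in S i].
Proof. by apply: eq_forallb => i; rewrite ffunE sub1set. Qed.

Lemma is_boxP S : reflect ((forall i, exists j, j \in S i) /\ box_le S full_box) (is_box S).
Proof.
apply: (iffP forallP) => [H|[H1 /forallP H2] i].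
  split=> [i|]; first by have /andP[/set0Pn ] := H i.
  by apply/forallP => i; have /andP[_ ] := H i; rewrite ffunE.
by have := H2 i; rewrite ffunE => ->; rewrite andbT; apply/set0Pn.
Qed.

Lemma box_has_point S : is_box S -> exists v, box_le (point_box v) S.
Proof.
move=> /is_boxP[H _]; have [v Hv] := fin_all_exists H.
by exists (finfun v); rewrite point_box_le; apply/forallP => i; rewrite ffunE.
Qed.

Lemma is_box_point v : box_le (point_box v) full_box -> is_box (point_box v).
Proof.
by move=> H; apply/is_boxP; split=> // i; exists (v i); rewrite ffunE inE.
Qed.

Lemma box_dim_point v : box_dim (point_box v) = 0.
Proof. by apply: big1 => i _; rewrite ffunE cards1. Qed.

Definition subst (v : vert) (p : I * T) : vert := [ffun i => if i == p.1 then p.2 else v i].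

(** The edges of the face [S] at its vertex [v], each given by the coordinate that changes and its
    new value. Their number is the dimension of the face, since products of simplices are simple
    polytopes. *)
Definition moves (S : box) (v : vert) : {set I * T} :=
  [set p | (p.2 \in S p.1) && (p.2 != v p.1)].

Lemma card_moves S v : box_le (point_box v) S -> #|moves S v| = box_dim S.
Proof.
rewrite point_box_le => /forallP vS.
rewrite -sum1_card (eq_bigl (fun p => true && (p.2 \in S p.1 :\ v p.1))); last first.
  by move=> p; rewrite !inE andbC.
rewrite -(pair_big_dep xpredT (fun i j => j \in S i :\ v i) (fun _ _ => 1)) /=.
apply: eq_bigr => i _; rewrite sum1_card.
by have := cardsD1 (v i) (S i); rewrite vS => ->.
Qed.

Lemma subst_le S v p : box_le (point_box v) S -> p.2 \in S p.1 ->
  box_le (point_box (subst v p)) S.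
Proof.
rewrite !point_box_le => /forallP vS pS; apply/forallP => i.
by rewrite ffunE; case: eqP => [->|].
Qed.

Lemma subst_le_inv S v p : box_le (point_box (subst v p)) S -> p.2 \in S p.1.
Proof. by rewrite point_box_le => /forallP/(_ p.1); rewrite ffunE eqxx. Qed.

Lemma subst_inj v p q : p.2 != v p.1 -> q.2 != v q.1 -> subst v p = subst v q -> p = q.
Proof.
case: p q => [i j] [i' j'] /= ne ne' /ffunP e.
have := e i; rewrite !ffunE /= eqxx; case: eqP => [ii' jj'|_ jv]; last by rewrite jv eqxx in ne.
by rewrite ii' jj'.
Qed.

Lemma subst_neq v p : p.2 != v p.1 -> subst v p != v.
Proof. by apply: contraNneq => e; rewrite -e ffunE eqxx. Qed.

(** * Order embeddings of a skeleton into the poset of boxes *)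

Section SkeletonEmbedding.
Variables (k : nat) (psi : box -> box).

Definition low := [set S | is_box S & box_dim S <= k].

Hypothesis psi_box : forall S, S \in low -> is_box (psi S).
Hypothesis psi_le : forall S S', S \in low -> S' \in low ->
  box_le S S' = box_le (psi S) (psi S').
(** Images of distinct vertices have no face in common; hence choosing a vertex in each image gives
    an injection of the finite set of vertices into itself. *)
Hypothesis psi_point : forall v v' S, is_box (point_box v) -> is_box (point_box v') ->
  is_box S -> box_le S (psi (point_box v)) -> box_le S (psi (point_box v')) -> v = v'.

Let pts : {set vert} := [set v | box_le (point_box v) full_box].

Let pt_box v : v \in pts -> is_box (point_box v).
Proof. by rewrite inE => /is_box_point. Qed.

Let pt_low v : v \in pts -> point_box v \in low.
Proof. by move=> vp; rewrite inE pt_box // box_dim_point. Qed.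

Let box_pt S v : is_box S -> box_le (point_box v) S -> v \in pts.
Proof. by move=> /is_boxP[_ H] vS; rewrite inE; apply: box_le_trans vS H. Qed.

(* [psi] permutes the points; since it sends edges to edges it is an automorphism
   of the graph, and the dimension of a box is its degree in that graph. *)
Lemma low_surjective S : S \in low -> exists2 S', S' \in low & psi S' = S.
Proof.
have [tau Htau] : exists tau : vert -> vert, forall v, v \in pts ->
    box_le (point_box (tau v)) (psi (point_box v)).
  have ex v : exists w, v \in pts -> box_le (point_box w) (psi (point_box v)).
    case: (boolP (v \in pts)) => [vp|_]; last by exists v.
    by have [w Hw] := box_has_point (psi_box (pt_low vp)); exists w.
  exact: fin_all_exists ex.
have tau_pts v : v \in pts -> tau v \in pts.
  by move=> vp; apply: box_pt (Htau v vp); apply: psi_box; apply: pt_low.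
have tau_inj : {in pts &, injective tau}.
  move=> v w vp wp e.
  apply: (psi_point (pt_box vp) (pt_box wp) (pt_box (tau_pts v vp)) (Htau v vp)).
  by rewrite e; apply: Htau.
have tau_surj w : w \in pts -> exists2 v, v \in pts & w = tau v.
  suff E : tau @: pts = pts by rewrite -{1}E => /imsetP.
  apply/eqP; rewrite eqEcard card_in_imset // leqnn andbT.
  by apply/subsetP => _ /imsetP[v vp ->]; apply: tau_pts.
have tau_uniq v w : v \in pts -> box_le (point_box w) (psi (point_box v)) -> w = tau v.
  move=> vp wv; have wp : w \in pts by apply: box_pt wv; apply: psi_box; apply: pt_low.
  have [v' v'p e] := tau_surj w wp; rewrite e; congr tau.
  apply: (psi_point (pt_box v'p) (pt_box vp) (pt_box wp)) => //.
  by rewrite e; apply: Htau.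
have psi_pt v : v \in pts -> psi (point_box v) = point_box (tau v).
  move=> vp; apply: box_le_anti (Htau v vp); apply/box_leP => i j jp.
  rewrite ffunE inE -(tau_uniq v (subst (tau v) (i, j))) //.
    by rewrite ffunE eqxx.
  exact: subst_le (Htau v vp) _.
have tau_mem U v : U \in low -> v \in pts ->
    box_le (point_box (tau v)) (psi U) = box_le (point_box v) U.
  by move=> Ul vp; rewrite -psi_pt // -psi_le // pt_low.
have psi_dim U : U \in low -> box_dim (psi U) <= k.
  move=> Ul; have /[1!inE] /andP[Ubox Uk] := Ul.
  have [v vU] := box_has_point Ubox; have vp := box_pt Ubox vU.
  (* Edges belong to [low] only for [k > 0]; for [k = 0] every low box is a single vertex. *)
  case: (posnP k) => [k0|k_gt0].
    suff -> : U = point_box v by rewrite psi_pt // box_dim_point.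
    apply: box_le_anti (vU); apply/box_leP => i j jU; rewrite ffunE inE.
    have: #|moves U v| = 0 by rewrite card_moves //; move: Uk; rewrite k0 leqn0 => /eqP.
    move=> /eqP; rewrite cards_eq0 => /eqP/setP/(_ (i, j)); rewrite !inE jU /=.
    by move/negbFE.
  apply: leq_trans Uk.
  have edge p : p \in moves full_box v -> exists q, q \in moves full_box (tau v) /\
      tau (subst v p) = subst (tau v) q.
    rewrite inE => /andP[pD pv]; set w := subst v p.
    have wp : w \in pts by rewrite inE; apply: subst_le => //; move: vp; rewrite inE.
    pose E : box := [ffun i => [set v i; w i]].
    have vE : box_le (point_box v) E.
      by rewrite point_box_le; apply/forallP => i; rewrite ffunE !inE eqxx.
    have wE : box_le (point_box w) E.
      by rewrite point_box_le; apply/forallP => i; rewrite [E i]ffunE !inE eqxx orbT.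
    have Ebox : is_box E.
      apply/is_boxP; split=> [i|]; first by exists (v i); rewrite ffunE !inE eqxx.
      move: vp wp; rewrite !inE !point_box_le => /forallP vD /forallP wD.
      by apply/box_leP => i j; rewrite [E i]ffunE !inE => /orP[] /eqP ->.
    have Elow : E \in low.
      rewrite inE Ebox; apply: leq_trans k_gt0; rewrite -(card_moves vE).
      rewrite -(cards1 p); apply: subset_leq_card; apply/subsetP => q.
      rewrite !inE !ffunE !inE => /andP[/orP[/eqP ->|]]; first by rewrite eqxx.
      case: (q.1 =P p.1) => [q1 /eqP q2 _|_ /eqP ->]; last by rewrite eqxx.
      by rewrite [q]surjective_pairing q1 q2 -surjective_pairing.
    have E_pts u : u \in pts -> box_le (point_box u) E -> u = v \/ u = w.
      move=> up; rewrite point_box_le => /forallP uE.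
      have uE' i : i != p.1 -> u i = v i.
        by move=> ip; have := uE i; rewrite !ffunE !inE (negbTE ip) orbb => /eqP.
      have := uE p.1; rewrite !ffunE !inE eqxx => /orP[] /eqP up1.
        by left; apply/ffunP => i; have [->|/uE'] := eqVneq i p.1.
      right; apply/ffunP => i; rewrite ffunE; have [->|/uE'] := eqVneq i p.1; first by rewrite up1.
      by [].
    have psiE_box := psi_box Elow.
    have vw : tau v != tau w.
      by apply/eqP => /(tau_inj _ _ vp wp)/esym/eqP; apply/negP/subst_neq.
    have [i0 ne0] : exists i, tau v i != tau w i.
      by apply/existsP; apply: contraR vw => /existsPn H; apply/eqP/ffunP => i;
        apply/eqP; rewrite -[_ == _]negbK H.
    have tvE : box_le (point_box (tau v)) (psi E) by rewrite tau_mem.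
    have twE : box_le (point_box (tau w)) (psi E) by rewrite tau_mem.
    (* [tau v] with its coordinate [i0] taken from [tau w] still lies in [psi E], whose only
       vertices are [tau v] and [tau w]. It differs from [tau v], so it is [tau w]: adjacent
       vertices stay adjacent. *)
    pose q := (i0, tau w i0).
    have uE : box_le (point_box (subst (tau v) q)) (psi E).
      by apply: subst_le => //=; move: twE; rewrite point_box_le => /forallP.
    have up := box_pt psiE_box uE; have [u' u'p eu] := tau_surj _ up.
    have qv : q.2 != tau v q.1 by rewrite /= eq_sym.
    exists q; split.
      rewrite inE qv andbT; have := tau_pts w wp.
      by rewrite inE point_box_le => /forallP/(_ i0).
    rewrite eu tau_mem // in uE; have [e|e] := E_pts u' u'p uE.
      by have := subst_neq qv; rewrite eu e eqxx.
    by rewrite eu e.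
  have [h Hh] : exists h : I * T -> I * T, forall p, p \in moves full_box v ->
      h p \in moves full_box (tau v) /\ tau (subst v p) = subst (tau v) (h p).
    have ex p : exists q, p \in moves full_box v -> q \in moves full_box (tau v) /\
      tau (subst v p) = subst (tau v) q.
      case: (boolP (p \in moves full_box v)) => [/edge[q Hq]|_]; last by exists p.
      by exists q.
    exact: fin_all_exists ex.
  have vfull : box_le (point_box v) full_box by move: vp; rewrite inE.
  have tvfull : box_le (point_box (tau v)) full_box by have := tau_pts v vp; rewrite inE.
  have sub_pts p : p \in moves full_box v -> subst v p \in pts.
    by rewrite !inE => /andP[pD _]; apply: subst_le.
  have h_inj : {in moves full_box v &, injective h}.
    move=> p q pm qm e; have [_ ep] := Hh p pm; have [_ eq] := Hh q qm.
    move: ep; rewrite e -eq => /(tau_inj _ _ (sub_pts p pm) (sub_pts q qm)).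
    by move: pm qm; rewrite !inE => /andP[_ pv] /andP[_ qv]; apply: subst_inj.
  have h_surj : h @: moves full_box v = moves full_box (tau v).
    apply/eqP; rewrite eqEcard card_in_imset // !card_moves // leqnn andbT.
    by apply/subsetP => _ /imsetP[p pm ->]; case: (Hh p pm).
  have tvU : box_le (point_box (tau v)) (psi U) by rewrite tau_mem.
  (* Each neighbour of [tau v] in [psi U] is the image of a neighbour of [v] in [U], so the degree,
     which is the dimension, does not grow. *)
  rewrite -(card_moves vU) -(card_moves tvU).
  apply: leq_trans (leq_imset_card h _); apply: subset_leq_card.
  apply/subsetP => q qm; have : q \in moves full_box (tau v).
    move: qm; rewrite !inE => /andP[qU ->]; rewrite andbT.
    by have /is_boxP[_ /box_leP] := psi_box Ul; apply.
  rewrite -h_surj => /imsetP[p pm eq]; apply/imsetP; exists p => //.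
  have [_ etau] := Hh p pm; have := pm; rewrite !inE => /andP[_ ->]; rewrite andbT.
  apply: (subst_le_inv (v := v)); rewrite -tau_mem ?sub_pts // etau -eq.
  by apply: subst_le => //; move: qm; rewrite inE => /andP[].
(* By [psi_dim], [psi] maps the finite set [low] into itself; being injective there, it is onto. *)
have E : psi @: low = low.
  apply/eqP; rewrite eqEcard card_in_imset; last first.
    by move=> U U' Ul U'l e; apply: box_le_anti; rewrite psi_le // e box_le_refl.
  rewrite leqnn andbT; apply/subsetP => _ /imsetP[U Ul ->].
  by rewrite inE psi_box // psi_dim.
by rewrite -{1}E => /imsetP[S' S'l ->]; exists S'.
Qed.

End SkeletonEmbedding.
End Boxes.

Local Open Scope ring_scope.

(** * Discrete ham sandwich theorem in general position *)

(** The sum telescopes modulo 2 when the elements of [A] are added in increasing order of [key];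
    injectivity ensures that they enter one at a time. *)
Lemma sweep (K : realFieldType) (X : finType) (key : X -> K)
    (F : {set X} -> bool) (A : {set X}) :
  {in A &, injective key} ->
  F A (+) F set0 = \big[addb/false]_(x in A)
    (F (x |: [set y in A | key y < key x]) (+) F [set y in A | key y < key x]).
Proof.
have [n] := ubnP #|A|; elim: n A => // n IH A leAn injA.
have [->|[x0 x0A]] := set_0Vmem A; first by rewrite big_set0 addbb.
pose x1 := [arg max_(x > x0 in A) key x]%O.
have [x1A x1max] : x1 \in A /\ forall y, y \in A -> key y <= key x1.
  by rewrite /x1; case: arg_maxP.
have below1 : [set y in A | key y < key x1] = A :\ x1.
  apply/setP => y; rewrite !inE andbC; case yA: (y \in A); rewrite ?andbF ?andbT //.
  rewrite lt_neqAle x1max // andbT.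
  by apply/negb_inj; rewrite !negbK; apply/eqP/eqP => [/injA -> //|->].
rewrite (bigD1 x1) //= below1 setD1K //.
rewrite (eq_bigl (mem (A :\ x1))); last by move=> x; rewrite !inE andbC.
rewrite (eq_bigr (fun x => F (x |: [set y in A :\ x1 | key y < key x])
                   (+) F [set y in A :\ x1 | key y < key x])); last first.
  move=> x /setD1P[xx1 xA]; suff -> : [set y in A | key y < key x] =
    [set y in A :\ x1 | key y < key x] by [].
  apply/setP => y; rewrite !inE; case: (y =P x1) => [->|//].
  by rewrite x1A /= ltNge x1max.
rewrite -IH.
- by rewrite addbA addbK.
- by rewrite (cardsD1 x1) x1A in leAn.
- by move=> x y /setD1P[_ xA] /setD1P[_ yA]; apply: injA.
Qed.

(** Comparing enumeration ranks selects one element from each pair [x], [s x], which splits the sum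
    into two equal halves. *)
Lemma addb_involution (X : finType) (P : pred X) (F : X -> bool) (s : X -> X) :
  (forall x, P x -> P (s x)) -> (forall x, P x -> s (s x) = x) ->
  (forall x, P x -> s x != x) -> (forall x, P x -> F (s x) = F x) ->
  \big[addb/false]_(x | P x) F x = false.
Proof.
move=> Ps ss sx Fs.
rewrite (bigID (fun x => enum_rank x < enum_rank (s x))%N) /=.
rewrite [X in _ (+) X](reindex_onto s s) /=; last by move=> x /andP[/ss].
set a := bigop _ _ _; set b := bigop _ _ _; suff -> : b = a by exact: addbb.
apply: eq_big => [x|x /andP[/andP[Psx _] /eqP e]]; last by rewrite Fs // -e; apply: Ps.
apply/idP/idP => [/andP[/andP[Psx lt] /eqP e]|/andP[Px lt]].
  have Px : P x by rewrite -e Ps.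
  rewrite Px /= ltn_neqAle; rewrite e -leqNgt in lt; rewrite lt andbT.
  by move: (sx _ Px); apply: contra => /eqP/val_inj/enum_rank_inj/esym/eqP.
by rewrite Ps //= ss // eqxx andbT -leqNgt ltnW.
Qed.

(** * Functionals determined by the vectors on which they vanish *)

Section Generic.
Variables (K : realFieldType) (r : nat) (L : finType) (v : L -> 'rV[K]_r.+1).

Definition value (u : 'cV[K]_r.+1) (l : L) : K := (v l *m u) 0 0.

Lemma valueB u1 u2 l : value (u1 - u2) l = value u1 l - value u2 l.
Proof. by rewrite /value mulmxBr !mxE. Qed.

Lemma valueZ a u l : value (a *: u) l = a * value u l.
Proof. by rewrite /value -scalemxAr mxE. Qed.

(** General position with respect to the coordinate flag. If [y] is read as the coefficients of a
    polynomial, this is the property of the moment curve that a polynomial of degree below [#|A|]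
    with [#|A|] distinct roots is zero. *)
Definition generic := forall (A : {set L}) (y : 'cV[K]_r.+1),
  (#|A| <= r.+1)%N -> (forall j : 'I_r.+1, (#|A| <= j)%N -> y j 0 = 0) ->
  {in A, forall l, value y l = 0} -> y = 0.

Hypothesis gen : generic.

(** Its left kernel consists of the functionals of degree at most [#|A|] vanishing on [A]: the first
    block evaluates on [A], the second reads the coordinates beyond [#|A|]. For [#|A| <= r] there
    are [r] columns and [r.+1] rows, so the kernel is not zero. *)
Definition sys (A : {set L}) : 'M[K]_(r.+1, #|A| + (r - #|A|)) :=
  row_mx (\matrix_(j, i) v (enum_val i) 0 j)
         (\matrix_(j, i) (j == (#|A|.+1 + i)%N :> nat)%:R).

(* The functional of degree [#|A|] (its last nonzero coordinate, equal to 1)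
   that vanishes on [A]. *)
Definition wall (A : {set L}) : 'cV[K]_r.+1 :=
  let y := (nz_row (kermx (sys A)))^T in (y (inord #|A|) 0)^-1 *: y.

Lemma wallP (A : {set L}) : (#|A| <= r)%N ->
  [/\ wall A (inord #|A|) 0 = 1,
      forall j : 'I_r.+1, (#|A| < j)%N -> wall A j 0 = 0
    & {in A, forall l, value (wall A) l = 0}].
Proof.
move=> leAr; rewrite /wall; set y := _^T.
have y_nz : y != 0.
  rewrite -trmx0 (inj_eq trmx_inj) nz_row_eq0 -mxrank_eq0 mxrank_ker subn_eq0.
  rewrite -ltnNge ltnS; apply: leq_trans (rank_leq_col _) _.
  by rewrite subnKC.
have y_sys : y^T *m sys A = 0.
  by apply/sub_kermxP; rewrite trmxK nz_row_sub.
clearbody y; move: y_sys; rewrite mul_mx_row -row_mx0 => /eq_row_mx[y1 y2].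
have y_supp (j : 'I_r.+1) : (#|A| < j)%N -> y j 0 = 0.
  move=> Aj; have lt : (j - #|A|.+1 < r - #|A|)%N by have := ltn_ord j; lia.
  move/matrixP: y2 => /(_ 0 (Ordinal lt)); rewrite !mxE (bigD1 j) //= big1 ?addr0.
    by rewrite !mxE /= subnKC // eqxx mulr1.
  move=> i ij; rewrite !mxE /= subnKC // (_ : (i == j :> nat) = false) ?mulr0 //.
  exact/negbTE.
have y_A : {in A, forall l, value y l = 0}.
  move=> l lA; move/matrixP: y1 => /(_ 0 (enum_rank_in lA l)); rewrite !mxE => e.
  rewrite /value mxE -[RHS]e; apply: eq_bigr => j _.
  by rewrite !mxE enum_rankK_in // mulrC.
(* If this coordinate vanished, the degree of [y] would be below [#|A|] and genericity would give
   [y = 0]. Hence the normalisation in [wall] divides by a nonzero scalar. *)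
have y_top : y (inord #|A|) 0 != 0.
  apply: contra y_nz => /eqP y0; apply/eqP; apply: (gen (A := A)) => //.
    exact: leqW.
  move=> j; rewrite leq_eqVlt => /orP[/eqP Aj|]; last exact: y_supp.
  by rewrite -y0; congr (y _ 0); apply: val_inj; rewrite /= inordK // ltnS.
split; first by rewrite mxE mulVf.
  by move=> j /y_supp yj; rewrite mxE yj mulr0.
by move=> l lA; rewrite valueZ y_A ?mulr0.
Qed.

Lemma wall_uniq (A : {set L}) (y : 'cV[K]_r.+1) : (#|A| <= r)%N ->
  (forall j : 'I_r.+1, (#|A| < j)%N -> y j 0 = 0) ->
  {in A, forall l, value y l = 0} -> y = y (inord #|A|) 0 *: wall A.
Proof.
move=> leAr y_supp y_A; have [w1 ws wA] := wallP leAr.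
set a := y _ 0.
have entry j : (y - a *: wall A) j 0 = y j 0 - a * wall A j 0.
  by move: (wall A) => w; rewrite !mxE.
apply/eqP; rewrite -subr_eq0; apply/eqP/(gen (A := A)); first exact: leqW.
  move=> j; rewrite entry leq_eqVlt => /orP[/eqP Aj|Aj].
    have -> : j = inord #|A| by apply: val_inj; rewrite /= inordK // ltnS.
    by rewrite w1 mulr1 subrr.
  by rewrite y_supp // ws // mulr0 subr0.
by move=> l lA; rewrite valueB valueZ y_A // wA // mulr0 subr0.
Qed.

Lemma wall_neq0 (A : {set L}) l : (#|A| <= r)%N -> l \notin A ->
  value (wall A) l != 0.
Proof.
move=> leAr lA; have [w1 ws wA] := wallP leAr.
apply/eqP => wl; suff w0 : wall A = 0.
  by move: w1; rewrite w0 mxE => /eqP; rewrite eq_sym oner_eq0.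
apply: (gen (A := l |: A)).
- by rewrite cardsU1 lA ltnS.
- by move=> j; rewrite cardsU1 lA; apply: ws.
- by move=> l' /setU1P[->|/wA].
Qed.

(** Both walls on [#|A|.+1] vectors have leading coefficient 1 in the same degree, so their
    difference drops to degree [#|A|], vanishes on [A] and is a multiple of [wall A]. Vanishing at
    [w] determines the multiple. *)
Lemma wall_pencil (A : {set L}) w0 w : (#|A| < r)%N ->
  w0 \notin A -> w \notin A -> forall l,
  value (wall (w |: A)) l = value (wall (w0 |: A)) l
    - value (wall (w0 |: A)) w / value (wall A) w * value (wall A) l.
Proof.
move=> ltAr w0A wA.
have card_w x : x \notin A -> #|x |: A| = #|A|.+1 by move=> xA; rewrite cardsU1 xA.
have le_w x : x \notin A -> (#|x |: A| <= r)%N by move=> /card_w ->.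
have [a1 as_ aA] := wallP (le_w _ wA); have [b1 bs bA] := wallP (le_w _ w0A).
set y := wall (w0 |: A) - wall (w |: A).
have entry j : y j 0 = wall (w0 |: A) j 0 - wall (w |: A) j 0.
  by rewrite /y; move: (wall _) (wall _) => a b; rewrite !mxE.
have ey : y = y (inord #|A|) 0 *: wall A.
  apply: wall_uniq; first exact: ltnW.
    move=> j; rewrite leq_eqVlt => /orP[/eqP Aj|Aj]; last first.
      by rewrite entry bs ?card_w // as_ ?card_w // subr0.
    move: a1 b1; rewrite !card_w // (_ : inord _ = j); last first.
      by apply: val_inj; rewrite /= -Aj inordK // Aj ltn_ord.
    by rewrite entry => -> ->; rewrite subrr.
  by move=> l lA; rewrite valueB aA ?bA ?subrr // !inE lA orbT.
move: (y _ 0) ey => t ey.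
have val_y l : value (wall (w |: A)) l = value (wall (w0 |: A)) l - t * value (wall A) l.
  by rewrite -valueZ -ey valueB subKr.
have := val_y w; rewrite aA ?setU11 // => /esym/eqP; rewrite subr_eq0 => /eqP -> l.
by rewrite mulfK ?val_y // wall_neq0 // ltnW.
Qed.

End Generic.

Lemma big_addb_const (I : finType) (P : pred I) b :
  \big[addb/false]_(i | P i) b = odd #|P| && b.
Proof. by rewrite big_const; elim: #|P| => //= n ->; case: b; case: odd. Qed.

(** * Parity count of balanced transversals *)

Section Counting.
Variables (K : realFieldType) (r : nat) (L : finType) (v : L -> 'rV[K]_r.+1).
Variable col : L -> 'I_r.
Hypothesis gen : generic v.
Hypothesis odd_col : forall c, odd #|[set l | col l == c]|.

Definition npos (s : L -> K) c : nat := \sum_(l | col l == c) (0 < s l)%R.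
Definition nneg (s : L -> K) c : nat := \sum_(l | col l == c) (s l < 0)%R.

(** Here [s'] is a wall through [w] and [s] a functional of the pencil just before or just after it:
    within the block, only the sign at [w] is different. *)
Lemma count_sign (s s' : L -> K) (w : L) (c : 'I_r) : s' w = 0 ->
  (forall l, col l = c -> l != w -> Num.sg (s l) = Num.sg (s' l)) ->
  (npos s c = (col w == c) && (0 < s w)%R + npos s' c)%N /\
  (nneg s c = (col w == c) && (s w < 0)%R + nneg s' c)%N.
Proof.
move=> s'w ss'.
have eqs l : col l = c -> l != w ->
    (0 < s l) = (0 < s' l) /\ (s l < 0) = (s' l < 0).
  move=> cl lw; rewrite -[(0 < s l)]sgr_gt0 -[(s l < 0)]sgr_lt0 ss' //.
  by rewrite sgr_gt0 sgr_lt0.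
rewrite /npos /nneg; case: eqP => [cw|ncw]; last first.
  have lw l : col l = c -> l != w by move=> cl; apply/eqP => e; case: ncw; rewrite -e.
  by split; apply: eq_bigr => l /eqP cl; have [e1 e2] := eqs l cl (lw l cl); rewrite 1?e1 1?e2.
rewrite !(bigD1 (P := fun l => col l == c) w) ?cw //= s'w ltxx add0n.
by split; congr (_ + _)%N; apply: eq_bigr => l /andP[/eqP cl lw];
  have [e1 e2] := eqs l cl lw; rewrite 1?e1 1?e2.
Qed.

Lemma npos_nneg (s : L -> K) c (w : L) : col w = c -> s w = 0 ->
  (forall l, col l = c -> l != w -> s l != 0) ->
  odd (npos s c + nneg s c)%N = false.
Proof.
move=> cw sw nz; have := odd_col c; rewrite /npos /nneg -big_split /=.
rewrite -sum1_card (eq_bigl (fun l => col l == c)); last by move=> l; rewrite inE.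
rewrite !(bigD1 (P := fun l => col l == c) w) ?cw //= sw ltxx add0n.
rewrite addn0 add0n => /negbTE <-; congr odd.
apply: eq_bigr => l /andP[/eqP cl lw].
by case: ltrgt0P (nz _ cl lw).
Qed.

Lemma npos_neq_nneg (s : L -> K) c : (forall l, col l = c -> s l != 0) ->
  npos s c != nneg s c.
Proof.
move=> nz; have := odd_col c; rewrite -sum1_card.
rewrite (eq_bigl (fun l => col l == c)); last by move=> l; rewrite inE.
rewrite (eq_bigr (fun l => ((0 < s l)%R + (s l < 0)%R)%N)) => [|l /eqP cl].
  rewrite big_split /= -/(npos s c) -/(nneg s c) oddD.
  by apply: contraTneq => ->; rewrite addbb.
by case: ltrgt0P (nz _ cl).
Qed.

Definition balanced (s : L -> K) (c : 'I_r) := npos s c == nneg s c.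

Definition balanced_below (m : nat) (s : L -> K) :=
  [forall c : 'I_r, (c < m)%N ==> balanced s c].

Definition balanced_but (m : nat) (c0 : 'I_r) (s : L -> K) :=
  [forall c : 'I_r, (c < m)%N && (c != c0) ==> balanced s c].

Lemma balanced_below_split m (c0 : 'I_r) s : (c0 < m)%N ->
  balanced_below m s = balanced_but m c0 s && balanced s c0.
Proof.
move=> ltm; apply/forallP/andP => [H|[/forallP H H0] c].
  split; last by have /implyP := H c0; apply.
  by apply/forallP => c; apply/implyP => /andP[cm _]; have /implyP := H c; apply.
apply/implyP => cm; case: (c =P c0) => [->//|/eqP cc0].
by have /implyP := H c; apply; rewrite cm.
Qed.

Lemma balanced_belowS (m : 'I_r) s :
  balanced_below m.+1 s = balanced_below m s && balanced s m.
Proof.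
rewrite (balanced_below_split (c0 := m)) ?ltnSn //; congr andb.
apply: eq_forallb => c; rewrite ltnS [in RHS]ltn_neqAle andbC; congr (_ && _ ==> _).
Qed.

Lemma eq_balanced_below m s s' :
  (forall c : 'I_r, (c < m)%N -> balanced s c = balanced s' c) ->
  balanced_below m s = balanced_below m s'.
Proof.
move=> e; apply: eq_forallb => c; case: ltnP => //= /e ->//.
Qed.

Lemma eq_balanced_but m c0 s s' :
  (forall c : 'I_r, (c < m)%N -> c != c0 -> balanced s c = balanced s' c) ->
  balanced_but m c0 s = balanced_but m c0 s'.
Proof.
by move=> e; apply: eq_forallb => c; case: ltnP => //= cm; case: eqVneq => //= /e ->.
Qed.

(* The jump, when the pencil passes the functional [s] vanishing on a vector of
   block [c], of the truth value of "the blocks below m are balanced and block m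
   has a positive majority". *)
Definition jump (m : 'I_r) (c : 'I_r) (s : L -> K) : bool :=
  if c == m then balanced_below m.+1 s else
  balanced_but m c s && (nneg s m < npos s m)%N &&
  (((npos s c).+1 == nneg s c) (+) (npos s c == (nneg s c).+1)).

Definition transversal (g : {ffun 'I_r -> L}) := [forall c, col (g c) == c].

Definition head (m : nat) (g : {ffun 'I_r -> L}) : {set L} :=
  [set g c | c : 'I_r & (c < m)%N].

(** The vectors whose crossing can matter at level [m]: those of the blocks up to [m], except the
    ones in [A], on which the whole pencil vanishes. *)
Definition mid (m : 'I_r) (A : {set L}) := [set l | (col l <= m)%N && (l \notin A)].

Section Sweep1.
Variables (m : 'I_r) (g : {ffun 'I_r -> L}).
Hypothesis tg : transversal g.
Let A := head m g.

Let colg c : col (g c) = c. Proof. exact/eqP/(forallP tg). Qed.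

Lemma card_head (k : nat) : (k <= r)%N -> #|head k g| = k.
Proof.
move=> kr; rewrite card_in_imset; last first.
  by move=> c c' _ _ /(congr1 col); rewrite !colg.
rewrite -sum1_card (eq_bigl (fun c : 'I_r => c < k)%N); last first.
  by move=> c; rewrite inE.
by rewrite -(big_ord_widen r (fun=> 1%N) kr) sum1_card card_ord.
Qed.

Lemma in_head k l : (l \in head k g) = (col l < k)%N && (l == g (col l)).
Proof.
apply/imsetP/andP => [[c]|[lk /eqP e]]; last by exists (col l); rewrite // inE.
by rewrite inE => ck ->; rewrite colg.
Qed.

(** Outside [A], the functional [q - t p] of the pencil takes the value [p l * (tau l - t)] at [l].
    As [t] increases, the signs start as those of [p], and the sign at [l] is reversed at
    [t = tau l]; [flip B] is the sign pattern once the vectors of [B] have been crossed. *)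
Let p := value v (wall v A).
Let q := value v (wall v (g m |: A)).
Let tau l := q l / p l.
Let lam w := value v (wall v (w |: A)).
Let W := mid m A.
Let flip (B : {set L}) l := if l \in B then - p l else p l.
Let F (B : {set L}) := balanced_below m (flip B) &&
  (nneg (flip B) m < npos (flip B) m)%N.

Let cardA : #|A| = m. Proof. by rewrite card_head // ltnW. Qed.

Let gmA : g m \notin A. Proof. by rewrite in_head colg ltnn. Qed.

Let p_neq0 l : l \notin A -> p l != 0.
Proof. by move=> lA; apply: wall_neq0 => //; rewrite cardA ltnW. Qed.

Let p_A l : l \in A -> p l = 0.
Proof. by move=> lA; have := @wallP _ _ _ _ gen A; rewrite cardA ltnW // => /(_ isT)[_ _]; apply. Qed.

Let lamE w l : w \notin A -> lam w l = q l - tau w * p l.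
Proof. by move=> wA; apply: wall_pencil => //; rewrite cardA. Qed.

Let lam_neq0 w l : w \notin A -> l \notin A -> l != w -> lam w l != 0.
Proof.
move=> wA lA lw; apply: wall_neq0 => //; rewrite ?cardsU1 ?wA ?cardA //.
by rewrite !inE negb_or lw.
Qed.

Let lam_w w : w \notin A -> lam w w = 0.
Proof. by move=> wA; rewrite lamE // /tau divfK ?subrr // p_neq0. Qed.

Let lamD w l : w \notin A -> l \notin A -> lam w l = p l * (tau l - tau w).
Proof.
by move=> wA lA; rewrite lamE // mulrBr /tau [p l * (_ / _)]mulrC divfK ?p_neq0 // [p l * _]mulrC.
Qed.

Let tau_inj : {in W &, injective tau}.
Proof.
move=> w l; rewrite !inE => /andP[_ wA] /andP[_ lA] e.
apply/eqP; apply: contraT; rewrite eq_sym => /(lam_neq0 wA lA).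
by rewrite lamD // e subrr mulr0 eqxx.
Qed.

Let lamA w l : w \notin A -> l \in A -> lam w l = 0.
Proof.
move=> wA lA; have := @wallP _ _ _ _ gen (w |: A).
by rewrite cardsU1 wA cardA => /(_ (ltn_ord m))[_ _]; apply; rewrite !inE lA orbT.
Qed.

Let sg_flip w (B : {set L}) l : w \in W -> (col l <= m)%N -> l != w ->
  B :\ w = [set y in W | tau y < tau w] :\ w ->
  Num.sg (flip B l) = Num.sg (lam w l).
Proof.
move=> wW lm lw eB; have wA : w \notin A by move: wW; rewrite inE => /andP[].
have -> : flip B l = flip [set y in W | tau y < tau w] l.
  rewrite /flip (_ : (l \in B) = (l \in B :\ w)); last by rewrite in_setD1 lw.
  by rewrite eB in_setD1 lw.
rewrite /flip inE; case lA: (l \in A).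
  by rewrite p_A // lamA // oppr0; case: ifP.
move/negbT in lA; have lW : l \in W by rewrite inE lm lA.
rewrite lW lamD //= sgrM.
case: ltgtP => [lt|lt|e].
- by rewrite sgrN (@ltr0_sg _ (_ - _)) ?mulrN1 // subr_lt0.
- by rewrite (@gtr0_sg _ (_ - _)) ?mulr1 // subr_gt0.
- by move: lw; rewrite (tau_inj lW wW e) eqxx.
Qed.

(** Only the sign at [w] changes. If [w] is in block [m], the balance of the lower blocks is
    untouched and the majority in block [m] may be reversed; otherwise the majority in block [m] is
    untouched and only the balance of the block of [w] may change. *)
Lemma jump_eq w : w \in W ->
  F (w |: [set y in W | tau y < tau w]) (+) F [set y in W | tau y < tau w] =
  jump m (col w) (lam w).
Proof.
move=> wW; set B := [set y in W | _].
have [wm wA] : (col w <= m)%N /\ w \notin A by move: wW; rewrite inE => /andP.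
have lw := lam_w wA.
have wB : w \notin B by rewrite inE ltxx andbF.
have eB1 : (w |: B) :\ w = B :\ w.
  by apply/setP => l; rewrite !inE; case: (l =P w).
have sgB := sg_flip wW.
have cnt (B' : {set L}) (c : 'I_r) : (c <= m)%N -> B' :\ w = B :\ w ->
    npos (flip B') c = ((col w == c) && (0 < flip B' w)%R + npos (lam w) c)%N /\
    nneg (flip B') c = ((col w == c) && (flip B' w < 0)%R + nneg (lam w) c)%N.
  by move=> cm eB; apply: count_sign => // l cl lnw; apply: sgB; rewrite ?cl.
have cntB c cm := cnt B c cm erefl.
have cntB1 c cm := cnt (w |: B) c cm eB1.
have flipBw : flip B w = p w by rewrite /flip (negbTE wB).
have flipB1w : flip (w |: B) w = - p w by rewrite /flip setU11.
rewrite /F /jump.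
case: eqP => cw.
  have same B' : B' :\ w = B :\ w -> balanced_below m (flip B') = balanced_below m (lam w).
    move=> eB; apply: eq_balanced_below => c cm; rewrite /balanced.
    have [-> ->] := cnt B' c (ltnW cm) eB.
    by rewrite cw; case: (m =P c) => // e; rewrite e ltnn in cm.
  rewrite !same // balanced_belowS.
  have [-> ->] := cntB1 m (leqnn m); have [-> ->] := cntB m (leqnn m).
  rewrite cw eqxx /= flipBw flipB1w oppr_gt0 oppr_lt0 /balanced.
  have nz l : col l = m -> l != w -> lam w l != 0.
    by move=> cl lnw; apply: lam_neq0; rewrite // in_head cl ltnn.
  (* The majority is reversed exactly when the positive count at the wall exceeds the negative one
     by 0 or 1; their sum is even, which leaves only 0. *)
  have := npos_nneg cw lw nz.
  case: (balanced_below _ _) => //=.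
  move: (npos _ _) (nneg _ _) => a b.
  by case: ltrgt0P (p_neq0 wA) => //= _ _ par; apply/idP/idP; lia.
have ltwm : (col w < m)%N.
  by rewrite ltn_neqAle wm andbT; apply/eqP => /val_inj.
have same B' : B' :\ w = B :\ w ->
    balanced_but m (col w) (flip B') = balanced_but m (col w) (lam w).
  move=> eB; apply: eq_balanced_but => c cm cc; rewrite /balanced.
  have [-> ->] := cnt B' c (ltnW cm) eB.
  by rewrite [col w == c]eq_sym (negbTE cc).
rewrite !(balanced_below_split _ ltwm) !same //.
have [-> ->] := cntB1 m (leqnn m); have [-> ->] := cntB m (leqnn m).
rewrite /balanced.
have [-> ->] := cntB1 (col w) wm; have [-> ->] := cntB (col w) wm.
rewrite (negbTE (introN eqP cw)) eqxx /= flipBw flipB1w oppr_gt0 oppr_lt0.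
case: (balanced_but _ _ _) => //=; case: (_ < _)%N; rewrite ?andbF ?andbT //=.
by case: ltrgt0P (p_neq0 wA) => //= _ _; rewrite ?add0n ?add1n // addbC.
Qed.

(** At the two ends of the pencil all signs are opposite. The lower blocks are balanced at both ends
    or at neither, while the majority in block [m], which is odd and avoids [A], is reversed. So [F]
    differs between the ends exactly when the lower blocks are balanced, and [sweep] adds up the
    jumps. *)
Lemma sweep_head : balanced_below m p =
  \big[addb/false]_(w in W) jump m (col w) (lam w).
Proof.
rewrite -(eq_bigr _ jump_eq) -sweep // /F.
have e0 c : (npos (flip set0) c = npos p c) * (nneg (flip set0) c = nneg p c).
  by split; apply: eq_bigr => l _; rewrite /flip inE.
have eW (c : 'I_r) : (c <= m)%N ->
    (npos (flip W) c = nneg p c) * (nneg (flip W) c = npos p c).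
  move=> cm; split; apply: eq_bigr => l /eqP cl; rewrite /flip inE cl cm /=;
    by case: (boolP (l \in A)) => /= [/p_A ->|_]; rewrite ?ltxx ?oppr_gt0 ?oppr_lt0.
have -> : balanced_below m (flip set0) = balanced_below m p.
  by apply: eq_balanced_below => c _; rewrite /balanced !e0.
have -> : balanced_below m (flip W) = balanced_below m p.
  by apply: eq_balanced_below => c cm; rewrite /balanced !(eW _ (ltnW cm)) eq_sym.
rewrite !eW // !e0; case: (balanced_below m p) => //=.
have : npos p m != nneg p m.
  by apply: npos_neq_nneg => l cl; apply: p_neq0; rewrite in_head cl ltnn.
by case: ltngtP.
Qed.

End Sweep1.

Definition upd (g : {ffun 'I_r -> L}) (c : 'I_r) (w : L) : {ffun 'I_r -> L} :=
  [ffun c' => if c' == c then w else g c'].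

Lemma upd_transversal g c w : transversal g -> col w = c -> transversal (upd g c w).
Proof.
move=> /forallP tg cw; apply/forallP => c'; rewrite ffunE; case: (c' =P c) => [->|_] //.
exact/eqP.
Qed.

Lemma updK g c w : upd (upd g c w) c (g c) = g.
Proof. by apply/ffunP => c'; rewrite !ffunE; case: eqP => // ->. Qed.

Lemma upd_at g c w : upd g c w c = w.
Proof. by rewrite ffunE eqxx. Qed.

Lemma head_updS (m : 'I_r) g w : transversal g -> col w = m ->
  head m.+1 (upd g m w) = w |: head m g.
Proof.
move=> tg cw; apply/setP => l.
rewrite !inE !in_head ?upd_transversal // ltnS ffunE leq_eqVlt.
have [cl|ncl] := eqVneq (col l) m.
  by rewrite cl !eqxx /= ltnn andFb orbF.
rewrite (negbTE (ncl : col l != m :> nat)) /=.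
by case: (l =P w) => // e; move: ncl; rewrite e cw eqxx.
Qed.

Lemma head_upd_swap (m : nat) g w : transversal g -> (col w < m)%N ->
  g (col w) |: head m (upd g (col w) w) = w |: head m g.
Proof.
move=> tg cw; apply/setP => l; rewrite !inE !in_head ?upd_transversal // ffunE.
have cg : col (g (col w)) = col w by apply/eqP/(forallP tg).
have [cl|ncl] := eqVneq (col l) (col w).
  by rewrite cl cw /= orbC.
have neq x : col x = col w -> l == x = false by move=> cx; apply/eqP => e; rewrite e cx eqxx in ncl.
by rewrite (neq _ cg) (neq w).
Qed.

(* A crossing at [w] of an earlier block cancels against the one obtained by
   exchanging [w] with the vector of [g] in the same block: both happen at the
   same wall. *)
Lemma parity_step (m : 'I_r) :
  \big[addb/false]_(g | transversal g)
     balanced_below m (value v (wall v (head m g))) =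
  \big[addb/false]_(g | transversal g)
     balanced_below m.+1 (value v (wall v (head m.+1 g))).
Proof.
pose swap (gw : {ffun 'I_r -> L} * L) := (upd gw.1 (col gw.2) gw.2, gw.1 (col gw.2)).
have colg g c : transversal g -> col (g c) = c by move/forallP => tg; apply/eqP.
transitivity (\big[addb/false]_(g | transversal g)
  \big[addb/false]_(w in mid m (head m g)) jump m (col w) (value v (wall v (w |: head m g)))).
  by apply: eq_bigr => g tg; apply: sweep_head.
rewrite pair_big_dep /=.
rewrite (bigID (fun gw => col gw.2 == m)) /= [X in _ (+) X](addb_involution (s := swap)).
(* Crossings at [w] in block [m] are counted at the transversal [upd g m w]. Each transversal arises
   once for every vector of block [m] that [g] may have carried there, an odd number of times. *)
- rewrite addbF (eq_bigl (fun gw => transversal gw.1 && (col gw.2 == m))); last first.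
    case=> g w /=; rewrite /mid inE; case tg: (transversal g) => //=.
    by case: eqP => [e|_]; rewrite ?andbF ?andbT // in_head // e leqnn ltnn.
  rewrite (eq_bigr (fun gw => balanced_below m.+1
      (value v (wall v (head m.+1 (swap gw).1))))); last first.
    by case=> g w /= /andP[tg /eqP cw]; rewrite cw /jump eqxx head_updS.
  rewrite (reindex_onto swap swap) /=; last first.
    move=> [g w] /= /andP[tg /eqP cw]; rewrite /swap /= cw colg // updK upd_at //.
  rewrite (eq_bigl (fun gw => transversal gw.1 && (col gw.2 == m))); last first.
    move=> [g w] /=; apply/idP/idP => [/andP[/andP[tg /eqP cw]]|/andP[tg /eqP cw]].
      move=> /eqP [e1 e2]; rewrite cw in e1 e2.
      have cwm : col w = m by rewrite -e2 colg.
      by rewrite cwm eqxx andbT -e1; apply: upd_transversal.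
    rewrite cw colg // eqxx upd_transversal //= /swap /= cw colg // updK upd_at.
    exact: eqxx.
  rewrite -(pair_big_dep transversal (fun _ w => col w == m)
    (fun g w => balanced_below m.+1 (value v (wall v (head m.+1 (swap (swap (g, w))).1))))) /=.
  apply: eq_bigr => g tg.
  rewrite (eq_bigr (fun=> balanced_below m.+1 (value v (wall v (head m.+1 g))))).
    rewrite big_addb_const -(eq_card (A := [set l | col l == m])) ?odd_col //.
    by move=> l; rewrite inE.
  by move=> w /eqP cw; rewrite cw (colg g m tg) updK.
- move=> [g w] /= /andP[/andP[tg]]; rewrite inE => /andP[wm].
  rewrite in_head // negb_and => nw cw.
  rewrite upd_transversal //= inE in_head ?upd_transversal // colg // wm /= upd_at cw andbT.
  rewrite negb_and -leqNgt; apply/orP; right; rewrite eq_sym.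
  case/orP: nw => //; rewrite -leqNgt => mw; case/eqP: cw; apply/val_inj/eqP.
  by rewrite /= eqn_leq wm.
- by move=> [g w] /= /andP[/andP[tg _] _]; rewrite /swap /= colg // updK upd_at.
- move=> [g w] /= /andP[/andP[tg]]; rewrite inE => /andP[wm].
  rewrite in_head // negb_and => nw cw; apply/eqP => -[_ e]; move: nw.
  rewrite e eqxx orbF -leqNgt => mw; case/eqP: cw; apply/val_inj/eqP.
  by rewrite /= eqn_leq wm.
- move=> [g w] /= /andP[/andP[tg]]; rewrite inE => /andP[wm _] cw.
  have lt : (col w < m)%N by rewrite ltn_neqAle wm andbT.
  by rewrite (colg g _ tg) (head_upd_swap tg lt).
Qed.

Lemma odd_transversals : odd #|transversal|.
Proof.
rewrite (eq_card (B := family (fun c => [pred l | col l == c]))); last first.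
  by move=> g; apply/forallP/familyP.
have odds (s : seq 'I_r) :
  odd (foldr muln 1%N [seq #|[pred l | col l == c]| | c <- s]); last first.
  by rewrite card_family; apply: odds.
elim: s => //= c s IH.
rewrite oddM IH andbT; have := odd_col c.
by rewrite (eq_card (B := [pred l | col l == c])) // => l; rewrite inE.
Qed.

Lemma exists_balanced : exists A : {set L}, #|A| = r /\
  forall c, npos (value v (wall v A)) c = nneg (value v (wall v A)) c.
Proof.
have par m : (m <= r)%N -> \big[addb/false]_(g | transversal g)
    balanced_below m (value v (wall v (head m g))).
  elim: m => [_|m IH mr]; last by rewrite -(parity_step (Ordinal mr)) IH // ltnW.
  rewrite (eq_bigr (fun=> true)) ?big_addb_const ?odd_transversals //.
  by move=> g _; apply/forallP.
have [g /andP[tg /forallP bg]|none] := pickP (fun g => transversal g &&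
    balanced_below r (value v (wall v (head r g)))).
  exists (head r g); rewrite card_head //; split=> // c.
  by have /implyP/(_ (ltn_ord c))/eqP := bg c.
have := par r (leqnn r); rewrite big1 // => g tg.
by have := none g; rewrite tg.
Qed.

End Counting.

(** * Perturbation *)

Section NearZero.
Variable K : realFieldType.

(** Being true at all sufficiently small positive parameters; this filter plays the part of a limit
    at 0 from the right. *)
Definition near0 (P : K -> Prop) := exists2 d : K, 0 < d & forall e, 0 < e < d -> P e.

Lemma near0_and P Q : near0 P -> near0 Q -> near0 (fun e => P e /\ Q e).
Proof.
move=> [d d0 Pd] [d' d'0 Qd']; exists (Num.min d d'); first by rewrite lt_min d0.
by move=> e; rewrite lt_min => /and3P[e0 ed ed']; split; [apply: Pd|apply: Qd']; rewrite e0.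
Qed.

Lemma near0_imp (P Q : K -> Prop) : (forall e, 0 < e -> P e -> Q e) -> near0 P -> near0 Q.
Proof.
by move=> PQ [d d0 Pd]; exists d => // e ed; apply: PQ (Pd e ed); case/andP: ed.
Qed.

Lemma near0_all (X : finType) (P : X -> K -> Prop) :
  (forall x, near0 (P x)) -> near0 (fun e => forall x, P x e).
Proof.
move=> H; suff [d d0 Pd] : near0 (fun e => forall x, x \in enum X -> P x e).
  by exists d => // e ed x; apply: Pd; rewrite ?mem_enum.
elim: (enum X) => [|x s IH]; first by exists 1.
apply: near0_imp (near0_and (H x) IH) => e _ [Px Ps] y.
by rewrite inE => /orP[/eqP ->|/Ps].
Qed.

Lemma near0_ex P : near0 P -> exists e, P e.
Proof.
move=> [d d0 Pd]; exists (d / 2); apply: Pd.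
by rewrite divr_gt0 //= ltr_pdivrMr // mulr2n mulrDr mulr1 ltrDl.
Qed.

(** Write [p] as [p.[0]] plus ['X * q], with [q] bounded by [M] on the unit disk: the second term
    cannot outweigh [p.[0]] once [e] is below [p.[0] / (M + 1)]. *)
Lemma near0_horner_gt0 (p : {poly K}) : 0 < p.[0] -> near0 (fun e => 0 < p.[e]).
Proof.
move=> p0; have [q] : exists q, p = p.[0]%:P + 'X * q.
  exists ((p - p.[0]%:P) %/ 'X); rewrite mulrC divpK ?subrKC //.
  by rewrite -[X in X %| _]subr0 -polyC0 dvdp_XsubCl rootE !hornerE subrr.
have [M HM] := poly_disk_bound q 1.
have M0 : 0 <= M by apply: le_trans (HM 0 _); rewrite ?normr0.
move=> pE; exists (Num.min 1 (p.[0] / (M + 1))).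
  by rewrite lt_min ltr01 divr_gt0 // ltr_wpDl.
move=> e /andP[e0]; rewrite lt_min => /andP[e1 eM].
rewrite pE !hornerE -ltrBlDl sub0r.
have: - (e * M) <= e * q.[e].
  rewrite -mulrN ler_wpM2l ?(ltW e0) //.
  have /HM : `|e| <= 1 by rewrite gtr0_norm // ltW.
  by rewrite ler_norml => /andP[].
apply: lt_le_trans; rewrite ltrN2.
rewrite ltr_pdivlMr ?ltr_wpDl // in eM.
by apply: lt_trans eM; rewrite ltr_pM2l // ltrDl.
Qed.

Lemma near0_horner_neq0 (p : {poly K}) : p != 0 -> near0 (fun e => p.[e] != 0).
Proof.
move=> p0; have [m [q]] := multiplicity_XsubC p 0.
rewrite p0 subr0 /= rootE neq_lt => q0 ->.
have : near0 (fun e => q.[e] != 0).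
  case/orP: q0 => [qN|/near0_horner_gt0]; last first.
    by apply: near0_imp => e _ /lt0r_neq0.
  have /near0_horner_gt0 : 0 < (- q).[0] by rewrite hornerN oppr_gt0.
  by apply: near0_imp => e _; rewrite hornerN oppr_gt0 => /ltr0_neq0.
apply: near0_imp => e e0 qe; rewrite hornerM mulf_neq0 //.
by rewrite hornerXn expf_neq0 ?gt_eqF.
Qed.

(** Divide by ['X] as long as all coordinates vanish at 0; the size of a nonzero coordinate bounds
    the number of divisions. *)
Lemma polyvec_split n (y : 'cV[{poly K}]_n) : y != 0 ->
  exists k (z : 'cV[{poly K}]_n), y = 'X^k *: z /\ exists j, (z j 0).[0] != 0.
Proof.
move=> y0; have [j yj] : exists j, y j 0 != 0.
  by apply/existsP; apply: contraR y0 => /existsPn H; apply/eqP/matrixP => j i;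
    rewrite ord1 mxE; apply/eqP; rewrite -[_ == _]negbK H.
have [m] := ubnP (size (y j 0)); elim: m y yj {y0} => // m IH y yj sz.
have [/existsP ex|/existsPn none] := boolP [exists j, (y j 0).[0] != 0].
  by exists 0%N, y; rewrite expr0 scale1r.
pose y' : 'cV_n := \col_i (y i 0 %/ 'X).
have yE i : y i 0 = 'X * y' i 0.
  rewrite mxE mulrC divpK // -[X in X %| _]subr0 -polyC0 dvdp_XsubCl rootE.
  by rewrite -[_ == _]negbK none.
have y'j : y' j 0 != 0 by apply: contra yj => /eqP; rewrite yE => ->; rewrite mulr0.
have [|k [z [yz exz]]] := IH y' y'j.
  by move: sz; rewrite yE mulrC size_mulX.
exists k.+1, z; split=> //; apply/matrixP => i i'; rewrite ord1 yE yz !mxE.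
by rewrite mulrA -exprS.
Qed.

End NearZero.

Section Perturbation.
Variables (K : realFieldType) (r : nat) (L : finType) (v : L -> 'rV[K]_r.+1).

Definition node (l : L) : K := (enum_rank l)%:R.

Lemma node_inj : injective node.
Proof. by move=> l l' /eqP; rewrite eqr_nat => /eqP/val_inj/enum_rank_inj. Qed.

(** The segment from [v l], at parameter 0, to the point of the moment curve with parameter
    [node l], at parameter 1. *)
Definition homotopy (l : L) : 'rV[{poly K}]_r.+1 :=
  \row_j ((1 - 'X) * (v l 0 j)%:P + 'X * (node l ^+ j)%:P).

Definition homotopy_at (e : K) (l : L) : 'rV[K]_r.+1 := \row_j (homotopy l 0 j).[e].

Lemma homotopy_at0 l : homotopy_at 0 l = v l.
Proof. by apply/rowP => j; rewrite !mxE !hornerE ?(subr0, mul1r, mul0r, addr0). Qed.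

Lemma homotopy_at1 l j : homotopy_at 1 l 0 j = node l ^+ j.
Proof. by rewrite !mxE !hornerE ?(subrr, mul0r, add0r, mul1r). Qed.

(** The identity rows below the vectors of [A] force the high coordinates to vanish, so that for
    [#|A| <= r.+1] genericity for [A] becomes the nonvanishing of a single determinant, polynomial
    in the parameter. *)
Definition homotopy_mx (A : {set L}) : 'M[{poly K}]_r.+1 :=
  \matrix_(i, j) (if (i < #|A|)%N then nth 0 [seq homotopy l | l <- enum A] i 0 j
                  else (i == j)%:R).

Definition eval_mx e (A : {set L}) : 'M[K]_r.+1 := map_mx (horner_eval e) (homotopy_mx A).

Lemma det_eval e A : \det (eval_mx e A) = (\det (homotopy_mx A)).[e].
Proof. exact: det_map_mx. Qed.

Lemma homotopy_mx_in (A : {set L}) (i j : 'I_r.+1) (lt : (i < #|A|)%N) :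
  homotopy_mx A i j = homotopy (enum_val (Ordinal lt)) 0 j.
Proof.
rewrite mxE lt (nth_map (enum_val (Ordinal lt))); last by rewrite -cardE.
by rewrite [in RHS](enum_val_nth (enum_val (Ordinal lt))).
Qed.

Lemma homotopy_mx_out (A : {set L}) (i j : 'I_r.+1) : (#|A| <= i)%N ->
  homotopy_mx A i j = (i == j)%:R.
Proof. by rewrite mxE ltnNge => ->. Qed.

Lemma eval_mx_mul e (A : {set L}) (y : 'cV[K]_r.+1) : (#|A| <= r.+1)%N ->
  eval_mx e A *m y = 0 <->
  (forall j : 'I_r.+1, (#|A| <= j)%N -> y j 0 = 0) /\
  {in A, forall l, value (homotopy_at e) y l = 0}.
Proof.
move=> leA.
have out (i : 'I_r.+1) : (#|A| <= i)%N -> (eval_mx e A *m y) i 0 = y i 0.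
  move=> Ai; rewrite mxE (bigD1 i) //= big1 => [|j ji].
    by rewrite mxE homotopy_mx_out // eqxx /horner_eval hornerC mul1r addr0.
  by rewrite mxE homotopy_mx_out // eq_sym (negbTE ji) /horner_eval hornerC mul0r.
have inn (i : 'I_r.+1) (lt : (i < #|A|)%N) :
    (eval_mx e A *m y) i 0 = value (homotopy_at e) y (enum_val (Ordinal lt)).
  rewrite /value !mxE; apply: eq_bigr => j _.
  by rewrite mxE (homotopy_mx_in _ lt) [homotopy_at _ _ _ _]mxE.
split=> [/matrixP H|[H1 H2]].
  split=> [j Aj|l lA]; first by rewrite -out // H mxE.
  have ltA : (enum_rank_in lA l < #|A|)%N by exact: ltn_ord.
  have lt := leq_trans ltA leA.
  have := H (Ordinal lt) 0; rewrite [RHS]mxE (inn (Ordinal lt) ltA) => <-.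
  congr value; rewrite -[LHS](enum_rankK_in lA) //; congr enum_val; exact: val_inj.
apply/matrixP => i j; rewrite ord1 [RHS]mxE.
case: (ltnP i #|A|) => [lt|ge]; last by rewrite out // H1.
by rewrite (inn _ lt) H2 // enum_valP.
Qed.

(** It suffices to evaluate at 1. On the moment curve, a kernel vector is a polynomial of degree
    below [#|A|] vanishing at the [#|A|] distinct nodes. *)
Lemma det_homotopy_neq0 (A : {set L}) : (#|A| <= r.+1)%N -> \det (homotopy_mx A) != 0.
Proof.
move=> leA; suff : \det (eval_mx 1 A) != 0.
  by rewrite det_eval; apply: contraNneq => ->; rewrite horner0.
rewrite -det_tr; apply/det0P => -[y y0 /(congr1 trmx)].
rewrite trmx_mul trmxK trmx0 => /(eval_mx_mul _ _ leA)[ys yA].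
case/eqP: y0; pose p := \poly_(j < r.+1) y 0 (inord j).
have size_p : (size p <= #|A|)%N.
  apply/leq_sizeP => j Aj; rewrite coef_poly; case: ltnP => // jr.
  by have := ys (inord j); rewrite inordK // mxE => ->.
have p0 : p = 0.
  apply: (roots_geq_poly_eq0 (rs := [seq node l | l <- enum A])).
  - apply/allP => x /mapP[l]; rewrite mem_enum => lA ->.
    rewrite rootE horner_poly -[X in _ == X](yA l lA) /value mxE; apply/eqP.
    apply: eq_bigr => j _; rewrite homotopy_at1 [y^T _ _]mxE mulrC.
    by congr (_ * y 0 _); apply: val_inj; rewrite /= inordK.
  - by rewrite map_inj_uniq ?enum_uniq //; apply: node_inj.
  - by rewrite size_map -cardE.
apply/rowP => j; rewrite mxE.
have : p`_j = 0 by rewrite p0 coef0.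
by rewrite coef_poly ltn_ord => <-; congr (y 0 _); apply: val_inj; rewrite /= inordK.
Qed.

Lemma near0_generic : near0 (fun e => generic (homotopy_at e)).
Proof.
have : near0 (fun e => forall A : {set L}, (#|A| <= r.+1)%N -> \det (eval_mx e A) != 0).
  apply: near0_all => A; case: (leqP #|A| r.+1) => [le|gt]; last by exists 1.
  by apply: near0_imp (near0_horner_neq0 (det_homotopy_neq0 le)) => e _; rewrite det_eval.
apply: near0_imp => e _ H A y le ys yA.
have /eval_mx_mul : (#|A| <= r.+1)%N by [].
move=> /(_ e y)[_ /(_ (conj ys yA))] => My.
have u : eval_mx e A \in unitmx by rewrite unitmxE unitfE H.
by rewrite -[y](mulKmx u) My mulmx0.
Qed.

(* The wall is proportional to a vector of cofactors, polynomial in [e]; divided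
   by the largest possible power of [e] it has a nonzero limit at 0. *)
Lemma near0_wall (A : {set L}) : #|A| = r -> exists u : 'cV[K]_r.+1, u != 0 /\
  near0 (fun e => exists s, forall l,
    (0 < value v u l -> 0 < s * value (homotopy_at e) (wall (homotopy_at e) A) l) /\
    (value v u l < 0 -> s * value (homotopy_at e) (wall (homotopy_at e) A) l < 0)).
Proof.
(* The product of [homotopy_mx A] with this column of cofactors is zero except in the last row. As
   [#|A| = r], all other rows are vectors of [A], and the last is a unit row that reads off the
   determinant. *)
move=> cA; pose y := col ord_max (\adj (homotopy_mx A)).
have leA : (#|A| <= r.+1)%N by rewrite cA.
have yE j : y j 0 = (\adj (homotopy_mx A)) j ord_max by rewrite mxE.
have y_max : y ord_max 0 = \det (homotopy_mx A).
  have := congr1 (fun M : 'M_r.+1 => M ord_max ord_max) (mul_mx_adj (homotopy_mx A)).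
  rewrite mxE (bigD1 ord_max) //= big1 => [|j jm].
    by rewrite homotopy_mx_out ?cA // eqxx mul1r addr0 yE => ->; rewrite mxE eqxx.
  by rewrite homotopy_mx_out ?cA // eq_sym (negbTE jm) mul0r.
have D0 := det_homotopy_neq0 leA.
have y_neq0 : y != 0.
  by apply: contra D0 => /eqP e; rewrite -y_max e mxE.
have y_A l : l \in A -> \sum_j homotopy l 0 j * y j 0 = 0.
  move=> lA; have ltA : (enum_rank_in lA l < #|A|)%N by exact: ltn_ord.
  have lt := leq_trans ltA leA.
  have := congr1 (fun M : 'M_r.+1 => M (Ordinal lt) ord_max) (mul_mx_adj (homotopy_mx A)).
  rewrite [RHS]mxE (_ : Ordinal lt == ord_max = false); last first.
    by apply/eqP => /(congr1 val) /= e; move: ltA; rewrite e cA ltnn.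
  rewrite mulr0n => e; rewrite -[RHS]e mxE; apply: eq_bigr => j _.
  rewrite (homotopy_mx_in (i := Ordinal lt) _ ltA) yE; congr (homotopy _ _ _ * _).
  by rewrite -[LHS](enum_rankK_in lA) //; congr enum_val; exact: val_inj.
have [k [z [yz [j0 zj0]]]] := polyvec_split y_neq0.
have yzE j : y j 0 = 'X^k * z j 0 by rewrite yz mxE.
pose ev e : 'cV[K]_r.+1 := \col_j (z j 0).[e].
pose pz l := \sum_j homotopy l 0 j * z j 0.
have val_ev e l : value (homotopy_at e) (ev e) l = (pz l).[e].
  rewrite /value mxE /pz horner_sum; apply: eq_bigr => j _.
  by rewrite hornerM !mxE.
have val0 l : value v (ev 0) l = (pz l).[0].
  by rewrite -val_ev /value homotopy_at0.
exists (ev 0); split.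
  by apply: contra zj0 => /eqP/matrixP/(_ j0 0); rewrite !mxE => ->.
have signs : near0 (fun e => forall l,
    (0 < (pz l).[0] -> 0 < (pz l).[e]) /\ ((pz l).[0] < 0 -> (pz l).[e] < 0)).
  apply: near0_all => l; have [p0|p0|p0] := ltrgt0P (pz l).[0].
  - by apply: near0_imp (near0_horner_gt0 p0) => e _ ->.
  - have : 0 < (- pz l).[0] by rewrite hornerN oppr_gt0.
    by move/near0_horner_gt0; apply: near0_imp => e _; rewrite hornerN oppr_gt0 => ->.
  - by exists 1.
apply: near0_imp (near0_and signs near0_generic) => e e0 [sg gen].
(* Since walls have leading coefficient 1, the factor between [ev e] and the wall is the leading
   coefficient of [ev e]. *)
exists (ev e ord_max 0) => l.
have -> : ev e ord_max 0 * value (homotopy_at e) (wall (homotopy_at e) A) l =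
    value (homotopy_at e) (ev e) l.
  rewrite -valueZ; congr (value _ _ l).
  rewrite (_ : ord_max = inord r); last by apply: val_inj; rewrite /= inordK.
  have := @wall_uniq _ _ _ _ gen A (ev e); rewrite cA => /(_ (leqnn r)) uniq_ev.
  apply/esym/uniq_ev.
    by move=> j; rewrite ltnNge -ltnS ltn_ord.
  move=> l' lA; rewrite val_ev; apply: (mulfI (x := e ^+ k)).
    by rewrite expf_neq0 ?gt_eqF.
  rewrite mulr0 -hornerXn -hornerM -[RHS](horner0 e) -(y_A l' lA) /pz mulr_sumr.
  by congr (_.[e]); apply: eq_bigr => j _; rewrite yzE mulrCA.
by rewrite val0 val_ev; apply: sg.
Qed.

End Perturbation.

Theorem ham_sandwich (K : realFieldType) (r : nat) (L : finType)
    (v : L -> 'rV[K]_r.+1) (col : L -> 'I_r) :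
  (forall c, odd #|[set l | col l == c]|) ->
  exists u : 'cV[K]_r.+1, u != 0 /\ forall c,
    (2 * #|[set l | (col l == c) && (0 < value v u l)%R]| < #|[set l | col l == c]|)%N /\
    (2 * #|[set l | (col l == c) && (value v u l < 0)%R]| < #|[set l | col l == c]|)%N.
Proof.
move=> odd_col.
have ex_u (A : {set L}) : exists u : 'cV[K]_r.+1, #|A| = r -> u != 0 /\
  near0 (fun e => exists s, forall l,
    (0 < value v u l ->
       0 < s * value (homotopy_at v e) (wall (homotopy_at v e) A) l) /\
    (value v u l < 0 ->
       s * value (homotopy_at v e) (wall (homotopy_at v e) A) l < 0)).
  have [cA|ncA] := eqVneq #|A| r.
    by have [u Hu] := near0_wall v cA; exists u.
  by exists 0 => cA; rewrite cA eqxx in ncA.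
have [u Hu] := fin_all_exists ex_u; clear ex_u.
(* The set [A] supplied by the count depends on [e], so [e] is taken small enough for all sets of
   size [r] at once. *)
have [e [gen He]] : exists e, generic (homotopy_at v e) /\
   forall A : {set L}, #|A| = r -> exists s, forall l,
    (0 < value v (u A) l ->
       0 < s * value (homotopy_at v e) (wall (homotopy_at v e) A) l) /\
    (value v (u A) l < 0 ->
       s * value (homotopy_at v e) (wall (homotopy_at v e) A) l < 0).
  apply: near0_ex; apply: near0_and (near0_generic v) _.
  apply: near0_all => A; have [cA|ncA] := eqVneq #|A| r.
    by apply: near0_imp (Hu A cA).2 => e _.
  by exists 1 => // e _ cA; rewrite cA eqxx in ncA.
have [A [cA balA]] := exists_balanced gen odd_col.
have [s Hs] := He A cA; exists (u A); split=> [|c]; first by case: (Hu A cA).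
have := balA c; move: (value _ (wall _ A)) Hs {He balA} => w Hs.
have cardE (P : pred L) : #|[set l | (col l == c) && P l]| = (\sum_(l | col l == c) P l)%N.
  rewrite -sum1_card big_mkcond [RHS]big_mkcond; apply: eq_bigr => l _.
  by rewrite inE; case: (col l == c); case: (P l).
have : (npos col w c + nneg col w c <= #|[set l | col l == c]|)%N.
  rewrite /npos /nneg -big_split -sum1_card /=.
  rewrite [X in (_ <= X)%N](eq_bigl (fun l => col l == c)); last by move=> l; rewrite inE.
  by apply: leq_sum => l _; case: ltrgt0P.
have := odd_col c; rewrite !cardE.
set a := (\sum_(l | _) _)%N; set b := (\sum_(l | _) _)%N => oddc le eq_pn.
have [] : (a <= npos col w c)%N /\ (b <= npos col w c)%N; last by lia.
(* Strict signs at the limit persist for the perturbed wall, up to the sign of [s]: a negative [s]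
   exchanges the two sides, and [s = 0] means that no vector lies strictly on a side. Equal
   perturbed counts in an odd block give the strict inequalities. *)
have [s0|s0|s0] := ltrgt0P s.
- split; [|rewrite eq_pn]; apply: leq_sum => l _; have [H1 H2] := Hs l.
    by case: ltP H1 => // _ /(_ isT); rewrite pmulr_rgt0 // => ->.
  by case: ltP H2 => // _ /(_ isT); rewrite pmulr_rlt0 // => ->.
- split; [rewrite eq_pn|]; apply: leq_sum => l _; have [H1 H2] := Hs l.
    by case: ltP H1 => // _ /(_ isT); rewrite nmulr_rgt0 // => ->.
  by case: ltP H2 => // _ /(_ isT); rewrite nmulr_rlt0 // => ->.
- split; apply: leq_trans (leq0n _); apply: eq_leq; apply: big1 => l _;
    have [H1 H2] := Hs l.
    by case: ltP H1 => // _ /(_ isT); rewrite s0 mul0r ltxx.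
  by case: ltP H2 => // _ /(_ isT); rewrite s0 mul0r ltxx.
Qed.

(** * Facets of polytopes *)

Section Dot.
Variable K : realFieldType.

Lemma dotvE d (x c : 'rV[K]_d) : dotv x c = (x *m c^T) 0 0.
Proof. by rewrite mxE; apply: eq_bigr => j _; rewrite mxE. Qed.

Lemma dotvBl d (x y c : 'rV[K]_d) : dotv (x - y) c = dotv x c - dotv y c.
Proof. by rewrite !dotvE mulmxBl !mxE. Qed.

Lemma dotvBr d (x c c' : 'rV[K]_d) : dotv x (c - c') = dotv x c - dotv x c'.
Proof. by rewrite !dotvE linearB /= mulmxBr !mxE. Qed.

Lemma dotvDr d (x c c' : 'rV[K]_d) : dotv x (c + c') = dotv x c + dotv x c'.
Proof. by rewrite !dotvE linearD /= mulmxDr !mxE. Qed.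

Lemma dotvZl d a (x c : 'rV[K]_d) : dotv (a *: x) c = a * dotv x c.
Proof. by rewrite !dotvE -scalemxAl mxE. Qed.

Lemma dotvZr d a (x c : 'rV[K]_d) : dotv x (a *: c) = a * dotv x c.
Proof. by rewrite !dotvE linearZ -scalemxAr mxE. Qed.

Lemma dotv_suml d (I : finType) (F : I -> 'rV[K]_d) c :
  dotv (\sum_i F i) c = \sum_i dotv (F i) c.
Proof.
rewrite dotvE mulmx_suml summxE; apply: eq_bigr => i _; by rewrite dotvE.
Qed.

Lemma dotv0r d (x : 'rV[K]_d) : dotv x 0 = 0.
Proof. by rewrite dotvE trmx0 mulmx0 mxE. Qed.

Lemma dotv_mul d e (x : 'rV[K]_e) (A : 'M_(e, d)) c :
  dotv (x *m A) c = dotv x (c *m A^T).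
Proof. by rewrite !dotvE trmx_mul trmxK mulmxA. Qed.

Lemma mem_conv d (V : seq 'rV[K]_d) s : s \in V -> conv V s.
Proof.
move=> sV; have lt : (index s V < size V)%N by rewrite index_mem.
exists (fun i => (i == Ordinal lt)%:R); split=> [i||]; first by rewrite ler0n.
  by rewrite (bigD1 (Ordinal lt)) //= eqxx big1 ?addr0 // => i /negbTE ->.
rewrite (bigD1 (Ordinal lt)) //= eqxx scale1r big1 ?addr0 ?nth_index //.
by move=> i /negbTE ->; rewrite scale0r.
Qed.

Lemma conv_dot_le d (V : seq 'rV[K]_d) c b x :
  (forall s, s \in V -> dotv s c <= b) -> conv V x -> dotv x c <= b.
Proof.
move=> H [w [w0 w1 ->]]; rewrite dotv_suml -[b]mul1r -w1 mulr_suml.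
by apply: ler_sum => i _; rewrite dotvZl ler_wpM2l // H // mem_nth.
Qed.

Lemma conv_dot_eq d (V : seq 'rV[K]_d) c b x :
  (forall s, s \in V -> dotv s c = b) -> conv V x -> dotv x c = b.
Proof.
move=> H [w [w0 w1 ->]]; rewrite dotv_suml -[b]mul1r -w1 mulr_suml.
by apply: eq_bigr => i _; rewrite dotvZl H // mem_nth.
Qed.

End Dot.

Lemma seq_argmin (K : realFieldType) (X : eqType) (f : X -> K) (s : seq X) x0 :
  x0 \in s -> exists2 x, x \in s & forall y, y \in s -> f x <= f y.
Proof.
elim: s x0 => // x s IH x0 _; case: s IH => [|z s] IH.
  by exists x; rewrite ?mem_head // => y; rewrite inE => /eqP ->.
have [m ms Hm] := IH z (mem_head _ _); case: (leP (f x) (f m)) => le.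
  exists x; rewrite ?mem_head // => y; rewrite inE => /orP[/eqP ->//|/Hm].
  exact: le_trans.
exists m; first by rewrite inE ms orbT.
by move=> y; rewrite inE => /orP[/eqP ->|/Hm //]; apply: ltW.
Qed.

Lemma count_ltn (X : eqType) (P Q : pred X) (s : seq X) x :
  {in s, subpred P Q} -> x \in s -> Q x -> ~~ P x -> (count P s < count Q s)%N.
Proof.
elim: s => // y s IH PQ xs Qx nPx /=.
have PQs : {in s, subpred P Q} by move=> z zs; apply: PQ; rewrite inE zs orbT.
have le_s : (count P s <= count Q s)%N.
  rewrite -!size_filter; apply: (leq_trans (n := count Q [seq z <- s | P z])).
    rewrite leq_eqVlt eq_sym -all_count.
    by apply/orP; left; apply/allP => z; rewrite mem_filter => /andP[Pz zs]; apply: PQs.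
  by rewrite count_filter size_filter; apply: sub_count => z /andP[].
have le_y : (P y <= Q y)%N.
  by case Py : (P y) => //; rewrite (PQ y (mem_head _ _) Py).
move: xs; rewrite inE => /orP[/eqP xy|xs].
  by rewrite -xy (negbTE nPx) Qx.
by rewrite -addnS leq_add // IH.
Qed.

Section Decomposition.
Variables (K : realFieldType) (e : nat) (V : seq 'rV[K]_e) (Q : 'rV[K]_e -> Prop).
Hypothesis QV : forall x, Q x <-> conv V x.
Variables (I : finType) (a : I -> 'rV[K]_e) (beta : I -> K).
Hypothesis facet_valid : forall i x, Q x -> dotv x (a i) <= beta i.
Hypothesis facet_above : forall c b, (forall x, Q x -> dotv x c <= b) ->
  (exists x, Q x /\ dotv x c = b) -> (exists x, Q x /\ dotv x c != b) ->
  exists i, (forall x, Q x -> dotv x c = b -> dotv x (a i) = beta i) /\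
            (exists x, Q x /\ dotv x (a i) != beta i).

Let QinV s : s \in V -> Q s. Proof. by move=> /mem_conv/QV. Qed.

(* Subtract from [c] the largest multiple of a facet functional that keeps it
   valid: the face it exposes grows. *)
Lemma facet_decomposition c b : (forall x, Q x -> dotv x c <= b) ->
  (exists x, Q x /\ dotv x c = b) ->
  exists t : I -> K, (forall i, 0 <= t i) /\
    forall x, Q x -> b - dotv x c = \sum_i t i * (beta i - dotv x (a i)).
Proof.
have [m] := ubnP (count (fun s => dotv s c != b) V).
elim: m c b => // m IH c b ltm valid nonempty.
case: (boolP (has (fun s => dotv s c != b) V)) => [/hasP[s0 s0V s0b]|/hasPn all_eq].
  2: exists (fun=> 0); split=> // x /QV xV; rewrite big1 => [|i _]; last by rewrite mul0r.
  2: by rewrite (@conv_dot_eq _ _ V c b x) ?subrr // => s /all_eq/negbNE/eqP.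
have [i [Hi [x1 [Qx1 x1i]]]] := facet_above valid nonempty (ex_intro _ s0 (conj (QinV s0V) s0b)).
pose V' := [seq s <- V | dotv s (a i) != beta i].
have [s1 s1V'] : exists s, s \in V'.
  case: (boolP (has (fun s => dotv s (a i) != beta i) V)) => [/hasP[s sV si]|/hasPn all_eq].
    by exists s; rewrite mem_filter si.
  case/eqP: x1i; apply: (@conv_dot_eq _ _ V); last exact/QV.
  by move=> s /all_eq/negbNE/eqP.
(* The least ratio of slacks over the generators off facet [i] is the largest admissible multiple.
   The new slack vanishes at the minimiser [s2], and generators already on the face stay there
   because facet [i] contains it; so fewer generators remain off the face. *)
have [s2] := seq_argmin (fun s => (b - dotv s c) / (beta i - dotv s (a i))) s1V'.
rewrite mem_filter => /andP[s2i s2V] s2min.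
set t0 := _ / _ in s2min.
have slack_i s : s \in V -> 0 <= beta i - dotv s (a i).
  by move=> /QinV/facet_valid; rewrite subr_ge0.
have slack_c s : s \in V -> 0 <= b - dotv s c.
  by move=> /QinV/valid; rewrite subr_ge0.
have t0_ge0 : 0 <= t0 by rewrite divr_ge0 ?slack_i ?slack_c.
have slackE x : (b - t0 * beta i) - dotv x (c - t0 *: a i) =
    (b - dotv x c) - t0 * (beta i - dotv x (a i)).
  by rewrite dotvBr dotvZr; ring.
have [t [t_ge0 Ht]] : exists t : I -> K, (forall i, 0 <= t i) /\
    forall x, Q x -> (b - t0 * beta i) - dotv x (c - t0 *: a i) =
      \sum_i t i * (beta i - dotv x (a i)).
  apply: IH.
  - rewrite ltnS in ltm; apply: leq_trans ltm; apply: (@count_ltn _ _ _ _ s2) => //.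
    + move=> s sV; apply: contra => /eqP sc; rewrite eq_sym -subr_eq0 slackE.
      by rewrite sc Hi ?subrr ?mulr0 ?subrr //; apply: QinV.
    + apply: contra s2i => /eqP sc; rewrite Hi //; exact: QinV.
    + rewrite negbK eq_sym -subr_eq0 slackE /t0 divfK ?subrr //.
      by rewrite subr_eq0 eq_sym.
  - move=> x /QV; apply: conv_dot_le => s sV; rewrite -subr_ge0 slackE subr_ge0.
    have [si|si] := eqVneq (dotv s (a i)) (beta i).
      by rewrite si subrr mulr0 slack_c.
    have pos : 0 < beta i - dotv s (a i).
      by rewrite lt_neqAle slack_i // andbT eq_sym subr_eq0 eq_sym.
    by rewrite -ler_pdivlMr // s2min // mem_filter si.
  - have [x [Qx xc]] := nonempty; exists x; split=> //; apply/eqP.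
    by rewrite eq_sym -subr_eq0 slackE xc Hi // !subrr mulr0 subrr.
exists (fun j => t j + (if j == i then t0 else 0)); split=> [j|x Qx].
  by rewrite addr_ge0 //; case: ifP.
have := Ht x Qx; rewrite slackE => /eqP; rewrite subr_eq => /eqP ->.
under [RHS]eq_bigr do rewrite mulrDl.
rewrite big_split /=; congr (_ + _).
by rewrite (bigD1 i) //= eqxx big1 ?addr0 // => j /negbTE ->; rewrite mul0r.
Qed.

End Decomposition.

(** * Faces of products of simplices *)

Section DeltaFaces.
Variables (K : realFieldType) (r : nat) (n : 'I_r -> nat).

Notation N := (Nmax n).
Notation space := 'rV[K]_(r * N).
Notation Dl := (@Delta K r n).

Definition simplex_vertices (i : 'I_r) : {set 'I_N} := [set j : 'I_N | (j <= n i)%N].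

Notation D := simplex_vertices.
Notation box := {ffun 'I_r -> {set 'I_N}}.
Implicit Types (S : box) (x : space).

Lemma lt_Nmax i : (n i < N)%N.
Proof. exact: (leq_bigmax i). Qed.

Lemma card_simplex_vertices i : #|D i| = (n i).+1.
Proof.
rewrite -sum1_card (eq_bigl (fun j : 'I_N => (j < (n i).+1)%N)); last first.
  by move=> j; rewrite inE.
by rewrite -(big_ord_widen N (fun=> 1%N) (lt_Nmax i)) sum1_card card_ord.
Qed.

Lemma dotv_mxvec x (C : 'M[K]_(r, N)) :
  dotv x (mxvec C) = \sum_i \sum_j vec_mx x i j * C i j.
Proof.
rewrite /dotv pair_big /=.
rewrite (reindex _ (curry_mxvec_bij _ _)) /=.
by apply: eq_bigr => -[i j] _; rewrite /= mxvecE mxE.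
Qed.

Definition box_face S x := Dl x /\ forall i j, j \notin S i -> vec_mx x i j = 0.

Definition vertex (v : {ffun 'I_r -> 'I_N}) : space := mxvec (\matrix_(i, j) (j == v i)%:R).

Lemma vertexE v i j : vec_mx (vertex v) i j = (j == v i)%:R.
Proof. by rewrite mxvecK mxE. Qed.

Lemma box_face_vertex S v : is_box D S ->
  box_le (point_box v) S <-> box_face S (vertex v).
Proof.
move=> /is_boxP[_ /box_leP SD]; rewrite point_box_le; split.
  move=> /forallP vS; split.
    split=> [i j|i j ij|i]; rewrite ?vertexE ?ler0n //.
      case: eqP => // e; have := SD i j; rewrite e vS ffunE inE => /(_ isT).
      by rewrite leqNgt -e ij.
    rewrite (bigD1 (v i)) //= vertexE eqxx big1 ?addr0 // => j /negbTE jv.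
    by rewrite vertexE jv.
  move=> i j; rewrite vertexE; case: eqP => // ->; by rewrite vS.
move=> [_ H]; apply/forallP => i; apply: contraT => /H.
by rewrite vertexE eqxx => /eqP; rewrite oner_eq0.
Qed.

Lemma box_face_neq0 S : is_box D S -> exists x, box_face S x.
Proof.
move=> bS; have [v vS] := box_has_point bS; exists (vertex v).
exact/box_face_vertex.
Qed.

Lemma box_face_subset S S' : is_box D S -> is_box D S' ->
  box_le S S' <-> subset_of (box_face S) (box_face S').
Proof.
move=> bS bS'; split.
  by move=> /box_leP le x [Dx Sx]; split=> // i j jS'; apply: Sx; apply: contra jS'; apply: le.
move=> sub; apply/box_leP => i j jS; have [v vS] := box_has_point bS.
have /(box_face_vertex _ bS) : box_le (point_box (subst v (i, j))) S by apply: subst_le.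
by move=> /sub/(box_face_vertex _ bS'); apply: subst_le_inv.
Qed.

(** The indicator matrix of [S] exposes it: rows sum to 1, so the value falls short of [r] by the
    mass lying outside [S]. *)
Lemma box_face_face S : is_box D S -> face Dl (box_face S).
Proof.
move=> bS; pose C : 'M[K]_(r, N) := \matrix_(i, j) (j \in S i)%:R.
have dotE x : Dl x -> r%:R - dotv x (mxvec C) = \sum_i \sum_j vec_mx x i j * (j \notin S i)%:R.
  move=> [_ _ x1]; rewrite dotv_mxvec -{1}(card_ord r) -sum1_card natr_sum -sumrB.
  apply: eq_bigr => i _; rewrite -[X in X - _](x1 i) -sumrB; apply: eq_bigr => j _.
  by rewrite [C i j]mxE; case: (j \in S i); rewrite /= ?mulr1 ?mulr0 ?subrr ?subr0.
have ge0 x : Dl x -> forall i j, 0 <= vec_mx x i j * (j \notin S i)%:R.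
  by move=> [x0 _ _] i j; rewrite mulr_ge0 ?ler0n.
exists (mxvec C), r%:R; split=> [x Dx|x].
  by rewrite -subr_ge0 dotE // sumr_ge0 // => i _; rewrite sumr_ge0 // => j _; apply: ge0.
split=> [[Dx Sx]|[Dx /eqP]].
  split=> //; apply/eqP; rewrite eq_sym -subr_eq0 dotE //; apply/eqP.
  apply: big1 => i _; apply: big1 => j _; case: (boolP (j \in S i)); rewrite ?mulr0 //.
  by move=> /Sx ->; rewrite mul0r.
rewrite eq_sym -subr_eq0 dotE // psumr_eq0; last first.
  by move=> i _; rewrite sumr_ge0 // => j _; apply: ge0.
move=> /allP H; split=> // i j jS.
have := H i (mem_index_enum i); rewrite psumr_eq0 /=; last by move=> j' _; apply: ge0.
by move=> /allP/(_ j (mem_index_enum j)); rewrite jS mulr1 => /eqP.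
Qed.

(** A linear functional is maximised factor by factor: [m i] is a best vertex of factor [i] and
    [S i] collects all of them. The face is empty when [b] exceeds the maximum [mu]. *)
Lemma Delta_face F : face Dl F ->
  (forall x, ~ F x) \/ exists S, is_box D S /\ forall x, F x <-> box_face S x.
Proof.
move=> [c [b [valid FE]]]; pose C : 'M[K]_(r, N) := vec_mx c.
have cC : c = mxvec C by rewrite vec_mxK.
have D0 i : exists j, j \in D i.
  by apply/set0Pn; rewrite -card_gt0 card_simplex_vertices.
have ex_max (i : 'I_r) : exists m, m \in D i /\ forall j, j \in D i -> C i j <= C i m.
  have [j0 j0D] := D0 i.
  have [j jD Hj] := @seq_argmin K _ (fun j => - C i j) (enum (D i)) j0
                      (etrans (mem_enum _ _) j0D).
  exists j; rewrite mem_enum in jD; split=> // j' j'D.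
  by rewrite -lerN2 Hj // mem_enum.
have [m Hm] := fin_all_exists ex_max.
pose mu := \sum_i C i (m i).
have dotE x : Dl x -> mu - dotv x c = \sum_i \sum_j vec_mx x i j * (C i (m i) - C i j).
  move=> [_ _ x1]; rewrite cC dotv_mxvec -sumrB; apply: eq_bigr => i _.
  rewrite -[X in X - _]mul1r -(x1 i) mulr_suml -sumrB; apply: eq_bigr => j _.
  by rewrite mulrBr.
have ge0 x : Dl x -> forall i j, 0 <= vec_mx x i j * (C i (m i) - C i j).
  move=> [x0 xD _] i j; case: (leqP j (n i)) => jn; last by rewrite xD // mul0r.
  by rewrite mulr_ge0 // subr_ge0; apply: (Hm i).2; rewrite inE.
have le_mu x : Dl x -> dotv x c <= mu.
  move=> Dx; rewrite -subr_ge0 dotE // sumr_ge0 // => i _.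
  by rewrite sumr_ge0 // => j _; apply: ge0.
pose S : box := [ffun i => [set j in D i | C i j == C i (m i)]].
have bS : is_box D S.
  apply/is_boxP; split=> [i|]; first by exists (m i); rewrite ffunE !inE eqxx andbT; have [] := Hm i; rewrite inE.
  by apply/box_leP => i j; rewrite !ffunE inE => /andP[].
have muE x : Dl x -> dotv x c = mu <-> box_face S x.
  move=> Dx; split=> [/eqP|[_ Sx]].
    rewrite eq_sym -subr_eq0 dotE // psumr_eq0; last first.
      by move=> i _; rewrite sumr_ge0 // => j _; apply: ge0.
    move=> /allP H; split=> // i j; rewrite ffunE !inE.
    case: (leqP j (n i)) => jn /=; last by case: Dx => _ xD _ _; apply: xD.
    have := H i (mem_index_enum i); rewrite psumr_eq0 /=; last by move=> j' _; apply: ge0.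
    move=> /allP/(_ j (mem_index_enum j)); rewrite mulf_eq0 subr_eq0 => /orP[/eqP ->//|].
    by rewrite eq_sym => ->.
  apply/eqP; rewrite eq_sym -subr_eq0 dotE //; apply/eqP.
  apply: big1 => i _; apply: big1 => j _.
  have [/Sx ->|] := boolP (j \notin S i); first by rewrite mul0r.
  by rewrite negbK ffunE inE => /andP[_ /eqP ->]; rewrite subrr mulr0.
have mub : mu <= b.
  have [x [Dx Sx]] := box_face_neq0 bS; rewrite -((muE x Dx).2 (conj Dx Sx)).
  exact: valid.
have [e|ne] := eqVneq mu b; last first.
  left=> x /FE[Dx xb]; have := le_mu x Dx; rewrite xb => bmu.
  by case/eqP: ne; apply/eqP; rewrite eq_le mub.
right; exists S; split=> // x; rewrite FE -e; split=> [[Dx /muE]|Sx]; first exact.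
by split; [case: Sx|apply/muE => //; case: Sx].
Qed.

(** The rows of a difference of two points of the face are supported in [S] and sum to 0, so its
    entries at [moves S v] determine it; there are [box_dim S] of these. *)
Lemma box_face_dim S k : is_box D S -> (box_dim S <= k)%N -> dim_le (box_face S) k.
Proof.
move=> bS Sk p pS; apply/negP => free.
have [v vS] := box_has_point bS.
pose A := \matrix_(i < k.+1) (p (lift ord0 i) - p ord0).
pose T := moves S v.
pose B : 'M[K]_(k.+1, #|T|) :=
  \matrix_(a, t) vec_mx (row a A) (enum_val t).1 (enum_val t).2.
suff : row_free B.
  move=> /eqP rB; have := rank_leq_col B; rewrite rB (card_moves vS).
  by rewrite leqNgt ltnS Sk.
have uA (u : 'rV_k.+1) i j :
    vec_mx (u *m A) i j = \sum_a u 0 a * vec_mx (row a A) i j.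
  rewrite mulmx_sum_row linear_sum summxE; apply: eq_bigr => a _.
  by rewrite linearZ [LHS]mxE.
have rowA a i j : vec_mx (row a A) i j =
    vec_mx (p (lift ord0 a)) i j - vec_mx (p ord0) i j.
  by rewrite rowK linearB [LHS]mxE [X in _ + X]mxE.
have outS (u : 'rV_k.+1) i j : j \notin S i -> vec_mx (u *m A) i j = 0.
  move=> jS; rewrite uA big1 // => a _.
  by rewrite rowA (pS (lift ord0 a)).2 // (pS ord0).2 // subrr mulr0.
have sum0 (u : 'rV_k.+1) i : \sum_j vec_mx (u *m A) i j = 0.
  under eq_bigr do rewrite uA.
  rewrite exchange_big big1 //= => a _.
  under eq_bigr do rewrite rowA.
  rewrite -mulr_sumr sumrB; have [[_ _ ->] _] := pS (lift ord0 a).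
  by have [[_ _ ->] _] := pS ord0; rewrite subrr mulr0.
have BE (u : 'rV_k.+1) (t : 'I_#|T|) :
    (u *m B) 0 t = vec_mx (u *m A) (enum_val t).1 (enum_val t).2.
  by rewrite uA mxE; apply: eq_bigr => a _; rewrite [B a t]mxE.
rewrite -kermx_eq0; apply/rowV0P => u /sub_kermxP uB.
apply/(row_free_inj free); rewrite mul0mx.
apply: (can_inj vec_mxK); rewrite linear0; apply/matrixP => i j; rewrite [RHS]mxE.
have off j' : j' != v i -> vec_mx (u *m A) i j' = 0.
  move=> jv; case: (boolP (j' \in S i)) => [jS|/outS //].
  have ijT : (i, j') \in T by rewrite inE /= jS.
  by have := BE u (enum_rank_in ijT (i, j')); rewrite enum_rankK_in // uB mxE.
have [->|/off //] := eqVneq j (v i).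
by have := sum0 u i; rewrite (bigD1 (v i)) //= big1 ?addr0.
Qed.

End DeltaFaces.

(** * Polytopes with the face lattice of a product, and their projections *)

Section FaceLattice.
Variables (K : realFieldType) (r : nat) (n : 'I_r -> nat).

Notation N := (Nmax n).
Notation Dl := (@Delta K r n).
Notation D := (@simplex_vertices r n).
Notation box := {ffun 'I_r -> {set 'I_N}}.

Lemma face_empty d (P : 'rV[K]_d -> Prop) : face P (fun _ => False).
Proof.
exists 0, 1; split=> [x _|x]; first by rewrite dotv0r ler01.
by split=> // -[_ /eqP]; rewrite dotv0r eq_sym oner_eq0.
Qed.

Lemma face_full d (P : 'rV[K]_d -> Prop) : face P P.
Proof.
by exists 0, 0; split=> [x _|x]; rewrite dotv0r //; split=> [|[]].
Qed.

Lemma faceI d (P F G : 'rV[K]_d -> Prop) : face P F -> face P G ->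
  face P (fun x => F x /\ G x).
Proof.
move=> [c [b [cb FE]]] [c' [b' [cb' GE]]]; exists (c + c'), (b + b'); split=> x.
  by move=> Px; rewrite dotvDr lerD ?cb ?cb'.
split=> [[/FE[Px xb] /GE[_ xb']]|[Px]]; first by rewrite dotvDr xb xb'.
rewrite dotvDr => e; have := cb x Px; have := cb' x Px => l' l.
split; [apply/FE|apply/GE]; split=> //; apply/eqP; rewrite eq_le ?l ?l' /=; lra.
Qed.

Section OfProduct.
Variables (e : nat) (Q : 'rV[K]_e -> Prop).

Definition exposed (c : box -> 'rV[K]_e) (b : box -> K) (S : box) (x : 'rV[K]_e) :=
  Q x /\ dotv x (c S) = b S.

(** The isomorphism of face lattices in explicit form: one supporting hyperplane is fixed for each
    box, which allows computing with slacks. *)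
Definition product_faces c b :=
  [/\ forall S, is_box D S -> forall x, Q x -> dotv x (c S) <= b S,
      forall S S', is_box D S -> is_box D S' ->
        box_le S S' <-> subset_of (exposed c b S) (exposed c b S'),
      forall F, face Q F -> (forall x, ~ F x) \/
        exists S, is_box D S /\ forall x, F x <-> exposed c b S x,
      forall S, is_box D S -> exists x, exposed c b S x
    & forall x, Q x -> exposed c b (full_box D) x].

Lemma is_box_full : is_box D (full_box D).
Proof.
apply/is_boxP; split=> [i|]; last exact: box_le_refl.
by apply/set0Pn; rewrite ffunE -card_gt0 card_simplex_vertices.
Qed.

Lemma comb_equiv_faces : comb_equiv Q Dl -> exists c b, product_faces c b.
Proof.
move=> [f [f_face f_surj f_le]].
have ex (S : box) : exists cb : 'rV[K]_e * K, is_box D S ->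
    (forall x, Q x -> dotv x cb.1 <= cb.2) /\
    exists F, [/\ face Q F, forall y, f F y <-> box_face S y
                & forall x, F x <-> (Q x /\ dotv x cb.1 = cb.2)].
  case: (boolP (is_box D S)) => [bS|_]; last by exists (0, 0).
  have [F [Fface FE]] := f_surj _ (box_face_face K bS).
  have [c [b [cb Fcb]]] := Fface.
  by exists (c, b) => _; split=> //; exists F.
have [cb Hcb] := fin_all_exists ex; clear ex.
exists (fun S => (cb S).1), (fun S => (cb S).2).
pose ex_face := exposed (fun S => (cb S).1) (fun S => (cb S).2).
have faceE S (bS : is_box D S) : exists F, [/\ face Q F,
    forall y, f F y <-> box_face S y & forall x, F x <-> ex_face S x].
  by have [_] := Hcb S bS.
have le S S' : is_box D S -> is_box D S' ->
    box_le S S' <-> subset_of (ex_face S) (ex_face S').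
  move=> bS bS'; have [F [Ff FE Fx]] := faceE S bS.
  have [F' [Ff' FE' Fx']] := faceE S' bS'.
  rewrite (box_face_subset K bS bS'); split=> sub.
    move=> x /Fx Fx1; apply/Fx'; move: x Fx1; apply/f_le => // y /FE/sub.
    by move/FE'.
  move=> y /FE Fy; apply/FE'; move: y Fy; apply/(f_le F F') => // x /Fx/sub.
  by move/Fx'.
have cases F : face Q F -> (forall x, ~ F x) \/
    exists S, is_box D S /\ forall x, F x <-> ex_face S x.
  move=> Fface; have [fF0|[S [bS FE]]] := Delta_face (f_face F Fface).
    left; apply/(f_le F (fun _ => False)) => //; first exact: face_empty.
    by move=> y /fF0.
  right; exists S; split=> // x; have [G [Gf GE Gx]] := faceE S bS.
  rewrite -Gx; split; move: x; apply/f_le => // y.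
    by move=> /FE/GE.
  by move=> /GE/FE.
(* An isomorphism respects least elements: an empty face for [S] would lie below the face sent to
   the empty one, and [box_face S] would be empty. *)
have nonempty S : is_box D S -> exists x, ex_face S x.
  move=> bS; apply: NNPP => none; have [F [Ff FE Fx]] := faceE S bS.
  have [G [Gf GE]] := f_surj _ (face_empty Dl).
  have [y yS] := box_face_neq0 K bS.
  apply/(GE y); move/FE: yS; move: y; apply/(f_le F G) => // x /Fx Fx1.
  by case: none; exists x.
split=> //.
  by move=> S bS; have [] := Hcb S bS.
move=> x Qx; have [Q0|[S [bS QS]]] := cases Q (face_full Q); first by case: (Q0 x).
have [_ /(le _ _ bS is_box_full)] := is_boxP _ _ bS; apply.
exact/QS.
Qed.

(** A face of [P] pulls back to a face of [Q], so the isomorphism of skeleta yields a map [psi] from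
    low boxes to boxes. It need not be the identity, but by [low_surjective] every low box [S] is
    some [psi S'], and the functional exposing the face of [P] for [S'] serves for [S]. *)
Lemma preserved_face d k (P : 'rV[K]_d -> Prop) (A : 'M[K]_(e, d)) c b :
  product_faces c b -> (forall y, P y <-> exists x, Q x /\ y = x *m A) ->
  skel_equiv k P Dl ->
  forall S, is_box D S -> (box_dim S <= k)%N -> exists c' b',
    (forall y, P y -> dotv y c' <= b') /\
    (forall x, Q x -> (dotv (x *m A) c' = b' <-> dotv x (c S) = b S)).
Proof.
move=> [valid le cases nonempty full] PQ [f [f_skel f_surj f_le]].
have PA x : Q x -> P (x *m A) by move=> Qx; apply/PQ; exists x.
have empty_skel : skeleton P k (fun _ => False).
  by split; [apply: face_empty|move=> p /(_ ord0)].
have ex (S : box) : exists U : box, S \in low D k -> is_box D U /\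
    exists G, [/\ skeleton P k G, forall y, f G y <-> box_face S y
                & forall x, Q x -> (G (x *m A) <-> exposed c b U x)].
  case: (boolP (S \in low D k)) => [|_]; last by exists S.
  rewrite inE => /andP[bS Sk].
  have [G [Gskel GE]] := f_surj _ (conj (box_face_face K bS) (box_face_dim bS Sk)).
  have [[cG [bG [cGb GcG]]] Gdim] := Gskel.
  have Hface : face Q (fun x => Q x /\ G (x *m A)).
    exists (cG *m A^T), bG; split=> [x Qx|x]; rewrite -dotv_mul; first by apply/cGb/PA.
    by split=> -[Qx] H; split=> //; [case/GcG: H|apply/GcG; split=> //; apply: PA].
  have [H0|[U [bU UE]]] := cases _ Hface.
    have [y yS] := box_face_neq0 K bS; exfalso.
    have [G0 [G0skel G0E]] := f_surj (fun _ => False) (conj (face_empty Dl) (fun p H => False_ind _ (H ord0))).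
    apply/(G0E y); move/GE: yS; move: y; apply/(f_le G G0) => // y Gy.
    have /GcG[/PQ[x [Qx yx]] _] := Gy.
    by case: (H0 x); rewrite -yx.
  exists U => _; split=> //; exists G; split=> // x Qx.
  by rewrite -UE; split=> [|[]].
have [psi Hpsi] := fin_all_exists ex; clear ex.
have psi_box S : S \in low D k -> is_box D (psi S) by move=> /Hpsi[].
have psi_le S S' : S \in low D k -> S' \in low D k ->
    box_le S S' = box_le (psi S) (psi S').
  move=> Sl Sl'; have [bU [G [Gs GE GU]]] := Hpsi S Sl.
  have [bU' [G' [Gs' GE' GU']]] := Hpsi S' Sl'.
  have bS : is_box D S by move: Sl; rewrite inE => /andP[].
  have bS' : is_box D S' by move: Sl'; rewrite inE => /andP[].
  apply/idP/idP.
    move/(box_face_subset K bS bS') => sub; apply/(le _ _ bU bU') => x Ux.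
    have Qx : Q x by case: Ux.
    apply/(GU' x Qx); move/(GU x Qx): Ux; move: (x *m A); apply/(f_le G G') => //.
    by move=> y /GE/sub/GE'.
  move/(le _ _ bU bU') => sub; apply/(box_face_subset K bS bS') => y /GE Gy.
  apply/GE'; move: y Gy; apply/(f_le G G') => // y Gy.
  have [[cG [bG [_ GcG]]] _] := Gs; have /GcG[/PQ[x [Qx yx]] _] := Gy.
  by move: Gy; rewrite yx => /(GU x Qx)/sub/(GU' x Qx).
have psi_point v v' T : is_box D (point_box v) -> is_box D (point_box v') ->
    is_box D T -> box_le T (psi (point_box v)) -> box_le T (psi (point_box v')) -> v = v'.
  move=> bv bv' bT.
  have lv : point_box v \in low D k by rewrite inE bv box_dim_point.
  have lv' : point_box v' \in low D k by rewrite inE bv' box_dim_point.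
  have [bU [G [Gs GE GU]]] := Hpsi _ lv; have [bU' [G' [Gs' GE' GU']]] := Hpsi _ lv'.
  move=> /(le _ _ bT bU) TU /(le _ _ bT bU') TU'.
  have [x Tx] := nonempty T bT; have Qx : Q x by case: Tx.
  (* If the two images share a face, the corresponding faces of [P] meet. Their intersection is in
     the skeleton and corresponds to a nonempty box below both vertices, which must then
     coincide. *)
  pose GG y := G y /\ G' y.
  have GGs : skeleton P k GG.
    split; first by apply: faceI; [case: Gs|case: Gs'].
    by case: Gs => _ dimG p pG; apply: dimG => i; case: (pG i).
  have [/Delta_face[none|[W [bW WE]]] _] := f_skel _ GGs.
    exfalso; apply: (proj2 (f_le GG (fun _ => False) GGs empty_skel)) => [y /none //|].
    by split; [apply/(GU x Qx)/TU|apply/(GU' x Qx)/TU'].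
  have Wv : box_le W (point_box v).
    apply/(box_face_subset K bW bv) => y /WE Wy; apply/GE; move: y Wy.
    by apply/(f_le GG G) => // y [].
  have Wv' : box_le W (point_box v').
    apply/(box_face_subset K bW bv') => y /WE Wy; apply/GE'; move: y Wy.
    by apply/(f_le GG G') => // y [].
  have [w wW] := box_has_point bW.
  have := box_le_trans wW Wv; have := box_le_trans wW Wv'; rewrite !point_box_le.
  move=> /forallP H' /forallP H; apply/ffunP => i.
  by have := H i; have := H' i; rewrite !ffunE !inE => /eqP <- /eqP.
move=> S bS Sk; have Sl : S \in low D k by rewrite inE bS.
have [S' S'l <-] := low_surjective psi_box psi_le psi_point Sl.
have [bU [G [Gs GE GU]]] := Hpsi S' S'l.
have [[cG [bG [cGb GcG]]] _] := Gs; exists cG, bG; split=> // x Qx; split=> H.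
  by have [] : exposed c b (psi S') x; first by apply/(GU x Qx)/GcG; split=> //; apply: PA.
by have /(GU x Qx)/GcG[] : exposed c b (psi S') x.
Qed.

End OfProduct.
End FaceLattice.

(** * The obstruction *)

Lemma split_sum (I : finType) (P : pred I) (F : I -> nat) k :
  (k <= \sum_(i | P i) F i)%N ->
  exists f : I -> nat, (forall i, P i -> f i <= F i)%N /\ (\sum_(i | P i) f i = k)%N.
Proof.
elim: k => [_|k IH lek]; first by exists (fun=> 0%N); rewrite big1.
have [f [fF fk]] := IH (ltnW lek).
have [i /andP[Pi lti]|none] := pickP (fun i => P i && (f i < F i)%N).
  exists (fun j => f j + (j == i))%N; split=> [j Pj|].
    by case: eqP => [->|_]; rewrite ?addn1 ?addn0 // fF.
  rewrite big_split /= fk (bigD1 i) //= eqxx big1 ?addn0 ?addn1 // => j /andP[_ /negbTE ->] //.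
move: lek; rewrite -fk ltnNge leq_sum // => i Pi.
by have := none i; rewrite Pi /= ltnNge => /negbFE.
Qed.

Lemma rowsub_free (K : fieldType) (m p q : nat) (A : 'M[K]_(m, p)) (h : 'I_q -> 'I_m) :
  injective h -> row_free A -> row_free (rowsub h A).
Proof.
move=> h_inj freeA; rewrite -kermx_eq0; apply/rowV0P => u /sub_kermxP.
rewrite rowsubE mulmxA -[0](mul0mx _ A) => /(row_free_inj freeA) uh.
apply/rowP => i; have /rowP/(_ (h i)) := uh; rewrite !mxE => <-.
rewrite (bigD1 i) //= !mxE eqxx mulr1 big1 ?addr0 // => j ji.
by rewrite !mxE (inj_eq h_inj) (negbTE ji) mulr0.
Qed.

Lemma exists_free_rows (K : fieldType) (m p q : nat) (A : 'M[K]_(m, p)) :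
  (q <= \rank A)%N -> exists h : 'I_q -> 'I_m, row_free (rowsub h A).
Proof.
move=> le; exists (maxrankfun A \o widen_ord le).
have -> : rowsub (maxrankfun A \o widen_ord le) A =
    rowsub (widen_ord le) (rowsub (maxrankfun A) A).
  by apply/matrixP => i j; rewrite !mxE.
apply: rowsub_free; last exact: maxrowsub_free.
by move=> i j /(congr1 val) /= /val_inj.
Qed.

Lemma exists_free_kernel (K : fieldType) (m p q : nat) (A : 'M[K]_(m, p)) :
  (q + \rank A <= m)%N -> exists U : 'M[K]_(q, m), row_free U /\ U *m A = 0.
Proof.
move=> le; have le' : (q <= \rank (kermx A))%N by rewrite mxrank_ker; lia.
pose B := row_base (kermx A); exists (rowsub (widen_ord le') B); split.
  apply: rowsub_free; last exact: row_base_free.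
  by move=> i j /(congr1 val) /= /val_inj.
have BA : B *m A = 0 by apply/sub_kermxP; rewrite eq_row_base.
by rewrite rowsubE -mulmxA BA mulmx0.
Qed.

Lemma dim_le_rank (K : realFieldType) (d m del : nat) (P : 'rV[K]_d -> Prop)
    (y0 : 'rV[K]_d) (Y : 'I_m -> 'rV[K]_d) :
  dim_le P del -> P y0 -> (forall i, P (Y i)) ->
  (\rank (\matrix_i (Y i - y0)) <= del)%N.
Proof.
move=> dimP Py0 PY; rewrite leqNgt; apply/negP => /exists_free_rows[h free].
pose p (i : 'I_del.+2) := if unlift ord0 i is Some a then Y (h a) else y0.
have pP i : P (p i) by rewrite /p; case: (unlift ord0 i).
have /negP := dimP p pP; apply; rewrite /aff_indep.
suff -> : \matrix_i (p (lift ord0 i) - p ord0) = rowsub h (\matrix_i (Y i - y0)) by [].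
by apply/matrixP => i j; rewrite !mxE /p liftK unlift_none.
Qed.

(* The extra coordinate 1 makes the bisecting hyperplane affine; moving it back
   to the origin, in the direction given by the sign of its offset, can only
   shrink its positive side. *)
Lemma few_positive (K : realFieldType) (r : nat) (L : finType) (w : L -> 'cV[K]_r)
    (col : L -> 'I_r) : (0 < r)%N ->
  (forall c, odd #|[set l | col l == c]|) ->
  exists u : 'rV[K]_r, u != 0 /\ forall c,
    (2 * #|[set l | (col l == c) && (0 < (u *m w l) 0 0)%R]| < #|[set l | col l == c]|)%N.
Proof.
move=> r_gt0 odd_col.
pose v l : 'rV[K]_r.+1 := row_mx (1%:M : 'M_1) (w l)^T.
have [u [u0 Hu]] := ham_sandwich v odd_col.
pose t := usubmx (u : 'cV[K]_(1 + r)) 0 0; pose u' := dsubmx (u : 'cV[K]_(1 + r)).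
have val_v l : value v u l = t + (u'^T *m w l) 0 0.
  have e : v l *m u = row_mx 1%:M (w l)^T *m col_mx (usubmx (u : 'cV[K]_(1 + r))) u'.
    by rewrite vsubmxK.
  rewrite /value e mul_row_col mul1mx mxE.
  by congr (_ + _); rewrite -{2}[w l]trmxK -trmx_mul [RHS]mxE.
(* With zero linear part the functional is the constant [t], nonzero as [u] is; a whole block would
   lie strictly on one side. *)
have u'0 : u' != 0.
  apply/negP => /eqP u'0; have val_t l : value v u l = t.
    by rewrite val_v u'0 trmx0 mul0mx mxE addr0.
  have [H1 H2] := Hu (Ordinal r_gt0).
  have [t0|t0|t0] := ltrgt0P t.
  - move: H1; rewrite (eq_card (B := [set l | col l == Ordinal r_gt0])); first by lia.
    by move=> l; rewrite !inE val_t t0 andbT.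
  - move: H2; rewrite (eq_card (B := [set l | col l == Ordinal r_gt0])); first by lia.
    by move=> l; rewrite !inE val_t t0 andbT.
  - case/eqP: u0; rewrite -[LHS](@vsubmxK _ 1 r) -/u' u'0.
    rewrite (_ : usubmx _ = 0) ?col_mx0 //.
    by apply/matrixP => i j; rewrite !ord1 -/t t0 mxE.
have [t0|t0] := leP 0 t.
  exists u'^T; split; first by rewrite -trmx0 (inj_eq trmx_inj).
  move=> c; have [H _] := Hu c; apply: leq_ltn_trans H; rewrite leq_mul2l /=.
  apply: subset_leq_card; apply/subsetP => l; rewrite !inE => /andP[-> pos] /=.
  by rewrite val_v ltr_wpDl.
exists (- u'^T); split; first by rewrite oppr_eq0 -trmx0 (inj_eq trmx_inj).
move=> c; have [_ H] := Hu c; apply: leq_ltn_trans H; rewrite leq_mul2l /=.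
apply: subset_leq_card; apply/subsetP => l; rewrite !inE => /andP[-> pos] /=.
move: pos; rewrite mulNmx mxE oppr_gt0 val_v => neg.
by rewrite -(addr0 (0 : K)) ltrD.
Qed.

Section Obstruction.
Variables (K : realFieldType) (r : nat) (n : 'I_r -> nat) (k d e : nat).
Variables (P : 'rV[K]_d -> Prop) (Q : 'rV[K]_e -> Prop) (A : 'M[K]_(e, d)).

Notation N := (Nmax n).
Notation D := (@simplex_vertices r n).
Notation box := {ffun 'I_r -> {set 'I_N}}.
Notation pair := ('I_r * 'I_N)%type.

Variables (c : box -> 'rV[K]_e) (b : box -> K).
Hypothesis n_gt0 : forall i, (0 < n i)%N.
Hypothesis PQ : forall y, P y <-> exists x, Q x /\ y = x *m A.
Hypothesis polyQ : polytope Q.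
Hypothesis Qfaces : product_faces Q c b.
Hypothesis preserved : forall S, is_box D S -> (box_dim S <= k)%N -> exists c' b',
    (forall y, P y -> dotv y c' <= b') /\
    (forall x, Q x -> (dotv (x *m A) c' = b' <-> dotv x (c S) = b S)).

Let FS := exposed Q c b.

(** The facet opposite to vertex [f.2] of factor [f.1]. All pairs are allowed as indices; when [f.2]
    is outside [D f.1] this is the full box and the slack is zero on [Q]. *)
Definition facet (f : pair) : box :=
  [ffun i => if i == f.1 then D i :\ f.2 else D i].

Definition slack (f : pair) x := b (facet f) - dotv x (c (facet f)).

Lemma facetP f i j : (j \in facet f i) = (j \in D i) && ((i, j) != f).
Proof.
case: f => i' j'; rewrite ffunE xpair_eqE /=; case: eqP => [->|_]; last by rewrite andbT.
by rewrite in_setD1 andbC.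
Qed.

Lemma other_vertex i j : exists j', (j' \in D i) && (j' != j).
Proof.
have /card_gt0P[j'] : (0 < #|D i :\ j|)%N.
  have := cardsD1 j (D i); rewrite card_simplex_vertices; have := n_gt0 i.
  by case: (j \in D i) => /=; lia.
by rewrite in_setD1 andbC => H; exists j'.
Qed.

Lemma is_box_facet f : is_box D (facet f).
Proof.
apply/is_boxP; split=> [i|].
  have [j /andP[jD jf]] := other_vertex i f.2; exists j; rewrite facetP jD /=.
  by apply: contra jf => /eqP <-.
by apply/box_leP => i j; rewrite facetP ffunE => /andP[].
Qed.

Lemma le_facet S f : is_box D S -> box_le S (facet f) = (f.2 \notin S f.1).
Proof.
move=> /is_boxP[_ /box_leP SD]; apply/box_leP/idP => [H|fS i j jS].
  by apply/negP => /H; rewrite facetP -surjective_pairing eqxx andbF.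
rewrite facetP; have := SD i j jS; rewrite ffunE => -> /=.
by apply: contra fS => /eqP <-.
Qed.

Lemma slack_ge0 f x : Q x -> 0 <= slack f x.
Proof. by case: Qfaces => valid _ _ _ _ Qx; rewrite subr_ge0 valid ?is_box_facet. Qed.

Lemma slack_eq0 f x : Q x -> slack f x = 0 <-> FS (facet f) x.
Proof.
move=> Qx; split=> [/eqP|[_ e0]]; last by rewrite /slack e0 subrr.
by rewrite subr_eq0 eq_sym => /eqP.
Qed.

Lemma slack_on S f x : is_box D S -> f.2 \notin S f.1 -> FS S x -> slack f x = 0.
Proof.
move=> bS fS Sx; have Qx : Q x by case: Sx.
apply/(slack_eq0 f Qx); case: Qfaces => _ le _ _ _.
by move: x Sx {Qx}; apply/(le _ _ bS (is_box_facet f)); rewrite le_facet.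
Qed.

Lemma slack_off S f : is_box D S -> f.2 \in S f.1 -> exists x, FS S x /\ slack f x != 0.
Proof.
move=> bS fS; apply: NNPP => none; have : box_le S (facet f).
  case: Qfaces => _ le _ _ _; apply/(le _ _ bS (is_box_facet f)) => x Sx.
  have Qx : Q x by case: Sx.
  apply/(slack_eq0 f Qx)/eqP; apply: contraT => nz; case: none; by exists x.
by rewrite le_facet // fS.
Qed.

Lemma slack_out f x : f.2 \notin D f.1 -> Q x -> slack f x = 0.
Proof.
move=> fD Qx; case: Qfaces => _ _ _ _ full.
by apply: slack_on (is_box_full n) _ (full x Qx); rewrite ffunE.
Qed.

(** A proper nonempty face misses some vertex [j] of some factor [i], hence lies in the proper facet
    [(i, j)]; this is the condition for [facet_decomposition]. *)
Lemma slack_decomposition c' b' : (forall x, Q x -> dotv x c' <= b') ->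
  (exists x, Q x /\ dotv x c' = b') ->
  exists t : pair -> K, (forall f, 0 <= t f) /\
    forall x, Q x -> b' - dotv x c' = \sum_f t f * slack f x.
Proof.
have [V QV] := polyQ; case: Qfaces => valid le cases nonempty full.
apply: (facet_decomposition QV) => [f x Qx|c1 b1 c1b1 [x1 [Qx1 x1b]] [x2 [Qx2 x2b]]].
  by apply: valid => //; apply: is_box_facet.
have F1 : face Q (fun x => Q x /\ dotv x c1 = b1) by exists c1, b1.
have [none|[S [bS SE]]] := cases _ F1; first by case: (none x1).
have [i /existsP[j /andP[jD jS]]] : exists i, [exists j, (j \in D i) && (j \notin S i)].
  apply/existsP; apply: contraT => /existsPn H; case/eqP: x2b.
  have [] // : Q x2 /\ dotv x2 c1 = b1; apply/SE.
  move: x2 Qx2 => x2 Qx2.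
  have : box_le (full_box D) S.
    apply/box_leP => i j; rewrite ffunE => jD.
    by have /existsPn/(_ j) := H i; rewrite jD negbK.
  by move/(le _ _ (is_box_full n) bS) => sub; apply/sub/full.
exists (i, j); split=> [x Qx xb|].
  have /SE Sx : Q x /\ dotv x c1 = b1 by [].
  have := slack_on (f := (i, j)) bS jS Sx.
  by move/eqP; rewrite subr_eq0 eq_sym => /eqP.
have [x [Fx nz]] := @slack_off (full_box D) (i, j) (is_box_full n) ltac:(by rewrite ffunE).
exists x; split; first by case: Fx.
by rewrite eq_sym -subr_eq0.
Qed.

Lemma lt0_Nmax (i : 'I_r) : (0 < N)%N.
Proof. exact: leq_ltn_trans (leq0n _) (lt_Nmax n i). Qed.

Definition origin : {ffun 'I_r -> 'I_N} := [ffun i => Ordinal (lt0_Nmax i)].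

Lemma origin_le : box_le (point_box origin) (full_box D).
Proof. by rewrite point_box_le; apply/forallP => i; rewrite !ffunE inE. Qed.

Definition directions : {set pair} := moves (full_box D) origin.

Notation J := directions.

Definition direction (t : 'I_#|J|) : pair := enum_val t.

Lemma card_J : #|J| = (\sum_i n i)%N.
Proof.
rewrite card_moves ?origin_le //; apply: eq_bigr => i _.
by rewrite ffunE card_simplex_vertices.
Qed.

(** * A frame at a vertex, and the rates of crossing the facets *)

Section Frame.
Variables (x0 : 'rV[K]_e) (xs : 'I_#|J| -> 'rV[K]_e).
Hypotheses (Q0 : Q x0) (Qs : forall t, Q (xs t)).
Hypothesis slack_x0 : forall t, slack (direction t) x0 = 0.
Hypothesis slack_xs : forall s t, (slack (direction s) (xs t) == 0) = (s != t).

Let X : 'M[K]_(#|J|, e) := \matrix_t (xs t - x0).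

(** The rate of decrease of the slack of [f] along [mu *m X]: positive when moving towards the
    facet. *)
Definition rate (mu : 'rV[K]_#|J|) (f : pair) : K := dotv (mu *m X) (c (facet f)).

Lemma dotv_frame (mu : 'rV[K]_#|J|) (c' : 'rV[K]_e) :
  dotv (mu *m X) c' = \sum_t mu 0 t * (dotv (xs t) c' - dotv x0 c').
Proof.
rewrite mulmx_sum_row dotv_suml; apply: eq_bigr => t _.
by rewrite rowK dotvZl dotvBl.
Qed.

Lemma rateE mu f : rate mu f = - \sum_t mu 0 t * (slack f (xs t) - slack f x0).
Proof.
rewrite /rate dotv_frame -[RHS]sumrN; apply: eq_bigr => t _.
by rewrite /slack; ring.
Qed.

Lemma rate_out mu f : f.2 \notin D f.1 -> rate mu f = 0.
Proof.
move=> fD; rewrite rateE big1 ?oppr0 // => t _.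
by rewrite !slack_out // subrr mulr0.
Qed.

Lemma rate_eq0 mu : (forall f, f.2 \in D f.1 -> rate mu f = 0) -> mu = 0.
Proof.
move=> H; apply/rowP => t; rewrite mxE.
have tD : (direction t).2 \in D (direction t).1.
  by have := (enum_valP t : direction t \in J); rewrite inE ffunE => /andP[].
have := H _ tD; rewrite rateE (bigD1 t) //= big1 => [|s st].
  move=> /eqP; rewrite addr0 slack_x0 subr0 oppr_eq0 mulf_eq0 slack_xs eqxx orbF.
  by move/eqP.
have /eqP -> : slack (direction t) (xs s) == 0 by rewrite slack_xs eq_sym.
by rewrite slack_x0 subrr mulr0.
Qed.

Section Kernel.
Variable mu : 'rV[K]_#|J|.
Hypothesis muXA : mu *m X *m A = 0.

(* A preserved face [S] gives weights [t], positive exactly on the facets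
   containing [S], with [sum_f t f * rate mu f = 0]. *)
Lemma rate_off S (s : K) : is_box D S -> (box_dim S <= k)%N ->
  (forall f, f.2 \in D f.1 -> f.2 \notin S f.1 -> s * rate mu f <= 0) -> s != 0 ->
  forall f, f.2 \in D f.1 -> f.2 \notin S f.1 -> rate mu f = 0.
Proof.
move=> bS Sk neg s0 f fD fS; have [c' [b' [valid' face']]] := preserved bS Sk.
have [_ le _ nonempty _] := Qfaces; have [xS FxS] := nonempty S bS.
have QxS : Q xS by case: FxS.
have valid x : Q x -> dotv x (c' *m A^T) <= b'.
  by move=> Qx; rewrite -dotv_mul; apply: valid'; apply/PQ; exists x.
have eqS x : Q x -> dotv x (c' *m A^T) = b' <-> FS S x.
  by move=> Qx; rewrite -dotv_mul (face' x Qx); split=> [|[]].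
have [||t [t_ge0 tE]] := @slack_decomposition (c' *m A^T) b'; first exact: valid.
  by exists xS; split=> //; apply/eqS.
have t_on g : t g != 0 -> g.2 \notin S g.1.
  move=> tg; apply/negP => gS; have [x [Sx]] := slack_off bS gS.
  have Qx : Q x by case: Sx.
  case/negP; have := tE x Qx; rewrite ((eqS x Qx).2 Sx) subrr => /esym/eqP.
  rewrite psumr_eq0 => [/allP/(_ g (mem_index_enum g))|h _].
    by rewrite mulf_eq0 (negbTE tg).
  by rewrite mulr_ge0 // slack_ge0.
(* The direction is killed by [A], so the functional pulled back from [P] is constant along it;
   expanding it into facet slacks gives the relation. *)
have sum0 : \sum_g t g * rate mu g = 0.
  have -> : \sum_g t g * rate mu g = dotv (mu *m X) (c' *m A^T).
    rewrite dotv_frame.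
    under eq_bigr do rewrite rateE mulrN mulr_sumr -sumrN.
    rewrite exchange_big /=; apply: eq_bigr => a _.
    have -> : dotv (xs a) (c' *m A^T) - dotv x0 (c' *m A^T) =
      (b' - dotv x0 (c' *m A^T)) - (b' - dotv (xs a) (c' *m A^T)) by ring.
    rewrite !tE // -sumrB mulr_sumr; apply: eq_bigr => g _; ring.
  by rewrite -dotv_mul muXA dotvE mul0mx mxE.
(* Otherwise all facets of nonzero weight contain the larger face [S'], obtained by adding [f.2] to
   factor [f.1]; then [S'] satisfies the equality exposing [S], which is absurd. *)
have t_f : t f != 0.
  apply/eqP => tf0; pose S' : box := [ffun i => if i == f.1 then f.2 |: S i else S i].
  have bS' : is_box D S'.
    have /is_boxP[S1 /box_leP SD] := bS; apply/is_boxP; split=> [i|].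
      by have [j jS] := S1 i; exists j; rewrite ffunE; case: ifP => // _; rewrite inE jS orbT.
    apply/box_leP => i j; rewrite !ffunE; case: eqP => [->|_] jS.
      by move: jS; rewrite inE => /orP[/set1P -> //|/SD]; rewrite ffunE.
    by have := SD i j jS; rewrite ffunE.
  have : box_le S' S.
    apply/(le _ _ bS' bS) => x S'x; have Qx : Q x by case: S'x.
    apply/(eqS x Qx)/eqP; rewrite eq_sym -subr_eq0 tE //; apply/eqP/big1 => g _.
    have [->|tg] := eqVneq (t g) 0; first by rewrite mul0r.
    have gS := t_on g tg; rewrite (slack_on bS' _ S'x) ?mulr0 //.
    rewrite ffunE; case: eqP => // g1; rewrite inE negb_or gS andbT inE.
    apply: contra tg => /eqP g2.
    by rewrite (_ : g = f) ?tf0 // [g]surjective_pairing g1 g2 -surjective_pairing.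
  by move/box_leP/(_ f.1 f.2); rewrite ffunE eqxx setU11 (negbTE fS) => /(_ isT).
have : \sum_g t g * - (s * rate mu g) == 0.
  under eq_bigr do rewrite -mulrN mulrCA mulrN.
  by rewrite -mulr_sumr sumrN sum0 oppr0 mulr0.
rewrite psumr_eq0 => [/allP/(_ f (mem_index_enum f))|g _].
  by rewrite mulf_eq0 (negbTE t_f) /= oppr_eq0 mulf_eq0 (negbTE s0) /= => /eqP.
have [->|/t_on gS] := eqVneq (t g) 0; first by rewrite mul0r.
rewrite mulr_ge0 // oppr_ge0; have [gD|gD] := boolP (g.2 \in D g.1); first exact: neg.
by rewrite rate_out // mulr0.
Qed.

Definition positive (i : 'I_r) : {set 'I_N} := [set j in D i | 0 < rate mu (i, j)].

(* The positive sets are completed by the origin where they are empty, which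
   costs nothing since [0.-1 = 0]. *)
Lemma kernel_trivial : (\sum_i #|positive i|.-1 <= k)%N -> mu = 0.
Proof.
move=> pos_k; pose S : box :=
  [ffun i => if positive i == set0 then [set origin i] else positive i].
have SE i j : j \in S i -> j \in positive i \/ positive i = set0 /\ j = origin i.
  by rewrite ffunE; case: eqP => [->|_]; [rewrite inE => /eqP; right|left].
have origin_D i : origin i \in D i by rewrite !ffunE inE.
have bS : is_box D S.
  apply/is_boxP; split=> [i|].
    apply/set0Pn; rewrite ffunE; case: ifP => [_|/negbT //].
    by apply/set0Pn; exists (origin i); rewrite inE.
  apply/box_leP => i j /SE[|[_ ->]]; rewrite [full_box _ _]ffunE //.
  by rewrite inE => /andP[].
have Sk : (box_dim S <= k)%N.
  apply: leq_trans pos_k; rewrite /box_dim; apply: leq_sum => i' _; rewrite ffunE.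
  by case: ifP => // _; rewrite cards1.
have off f : f.2 \in D f.1 -> f.2 \notin S f.1 -> rate mu f = 0.
  apply: (@rate_off S 1 bS Sk) => [{}f fD fS|]; last exact: oner_neq0.
  rewrite mul1r leNgt; apply: contra fS => pos_f; rewrite ffunE.
  have fpos : f.2 \in positive f.1 by rewrite inE fD -surjective_pairing.
  by case: eqP => // e0; rewrite e0 inE in fpos.
have point v : (forall i, v i \in D i) ->
    is_box D (point_box (finfun v)) /\ (box_dim (point_box (finfun v)) <= k)%N.
  move=> vD; split; last by rewrite box_dim_point.
  by apply: is_box_point; rewrite point_box_le; apply/forallP => i; rewrite !ffunE.
have [av Hav] : exists av : 'I_r -> 'I_N -> 'I_N, forall i j,
    (av i j \in D i) /\ (av i j != j).
  have ex (ij : pair) : exists j', (j' \in D ij.1) /\ (j' != ij.2).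
    by have [j' /andP[H1 H2]] := other_vertex ij.1 ij.2; exists j'.
  by have [g Hg] := fin_all_exists ex; exists (fun i j => g (i, j)) => i j; apply: (Hg (i, j)).
(* Negative rates can now occur only at the origin of factors without positive rates. The vertex [w]
   contains those origins and avoids a chosen positive index in every other factor. All rates off
   [w] are nonnegative, so [rate_off] with sign -1 makes them vanish, including the chosen positive
   ones. *)
have no_pos i : positive i = set0.
  pose w i := if [pick j in positive i] is Some j then av i j else origin i.
  have wD i' : w i' \in D i'.
    by rewrite /w; case: pickP => [j _|_] //; case: (Hav i' j).
  have [bw wk] := point w wD.
  have offw f : f.2 \in D f.1 -> f.2 != w f.1 -> rate mu f = 0.
    move=> fD fw; apply: (@rate_off _ (-1) bw wk) => //; last first.
    - by rewrite !ffunE inE.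
    - by rewrite oppr_eq0 oner_neq0.
    move=> g gD; rewrite !ffunE inE => gw; rewrite mulN1r oppr_le0 leNgt.
    apply: contra gw => neg_g; case: (boolP (g.2 \in S g.1)) => [/SE[|[e0 ->]]|gS].
    - by rewrite inE -surjective_pairing ltNge (ltW neg_g) andbF.
    - by rewrite /w; case: pickP => // j; rewrite e0 inE.
    - by rewrite (off g gD gS) ltxx in neg_g.
  apply/eqP; apply: contraT => /set0Pn[j jpos].
  have [j' j'pos wj'] : exists2 j', j' \in positive i & w i = av i j'.
    by rewrite /w; case: pickP => [j' j'pos|/(_ j)]; [exists j'|rewrite jpos].
  move: j'pos; rewrite inE => /andP[j'D]; rewrite (offw (i, j')) ?ltxx //=.
  by rewrite wj' eq_sym; case: (Hav i j').
have le0 f : f.2 \in D f.1 -> rate mu f <= 0.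
  move=> fD; rewrite leNgt; apply/negP => pos_f; have := no_pos f.1.
  by move=> /setP/(_ f.2); rewrite !inE -surjective_pairing pos_f andbT => e0; rewrite inE e0 in fD.
apply: rate_eq0 => f fD.
(* With no positive rate left, [rate_off] applies to any vertex; one that avoids [f] is used. *)
pose w i := if i == f.1 then av f.1 f.2 else origin i.
have wD i : w i \in D i.
  by rewrite /w; case: eqP => [->|_] //; case: (Hav f.1 f.2).
have [bw wk] := point w wD.
apply: (@rate_off _ 1 bw wk) => //; last first.
- by rewrite !ffunE inE /w eqxx eq_sym; case: (Hav f.1 f.2).
- exact: oner_neq0.
by move=> g gD _; rewrite mul1r le0.
Qed.

End Kernel.
End Frame.

(** The point [xs t] is taken on the edge leaving the origin in direction [t], off the facet of
    index [t]; all other facets of [directions] contain that edge. *)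
Lemma exists_frame : exists (x0 : 'rV[K]_e) (xs : 'I_#|J| -> 'rV[K]_e),
  [/\ Q x0, forall t, Q (xs t), forall t, slack (direction t) x0 = 0
    & forall s t, (slack (direction s) (xs t) == 0) = (s != t)].
Proof.
have [_ _ _ nonempty _] := Qfaces.
have b0 : is_box D (point_box origin) by apply: is_box_point; apply: origin_le.
have JP (t : 'I_#|J|) : (direction t).2 \in D (direction t).1 /\
    (direction t).2 != origin (direction t).1.
  by have := (enum_valP t : direction t \in J); rewrite inE [full_box _ _]ffunE => /andP[].
have [x0 x0P] := nonempty _ b0; exists x0.
have ex (t : 'I_#|J|) : exists x, Q x /\ forall s, (slack (direction s) x == 0) = (s != t).
  pose f := direction t; have [fD fo] := JP t.
  pose E : box := [ffun i => if i == f.1 then [set origin i; f.2] else [set origin i]].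
  have EE i j : (j \in E i) = (j == origin i) || ((i, j) == f).
    rewrite ffunE [f]surjective_pairing xpair_eqE /=.
    by case: eqP => _; rewrite !inE ?orbF.
  have bE : is_box D E.
    apply/is_boxP; split=> [i|]; first by exists (origin i); rewrite EE eqxx.
    apply/box_leP => i j; rewrite EE [full_box _ _]ffunE => /orP[/eqP ->|/eqP e1].
      by rewrite ffunE inE.
    by move: fD; rewrite -/f -e1.
  have fE : f.2 \in E f.1 by rewrite EE -surjective_pairing eqxx orbT.
  have [x [Ex nz]] := slack_off bE fE; exists x; split; first by case: Ex.
  move=> s; have [->|st] := eqVneq s t; first exact: negbTE.
  apply/eqP/(slack_on bE _ Ex); rewrite EE negb_or -surjective_pairing.
  by rewrite (JP s).2 /f /direction (inj_eq enum_val_inj).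
have [xs Hxs] := fin_all_exists ex; exists xs; split.
- by case: x0P.
- by move=> t; case: (Hxs t).
- by move=> t; apply: slack_on b0 _ x0P; rewrite ffunE inE; case: (JP t).
- by move=> s t; case: (Hxs t).
Qed.

Lemma card_dep_pairs (G : 'I_r -> {set 'I_N}) :
  #|[set p : pair | p.2 \in G p.1]| = (\sum_i #|G i|)%N.
Proof.
rewrite -sum1_card (eq_bigl (fun p : pair => true && (p.2 \in G p.1))); last first.
  by move=> p; rewrite inE.
rewrite -(pair_big_dep xpredT (fun i j => j \in G i) (fun _ _ => 1%N)) /=.
by apply: eq_bigr => i _; rewrite sum1_card.
Qed.

Lemma mxrank_row_mx_le (m p q : nat) (B : 'M[K]_(m, p)) (C : 'M[K]_(m, q)) :
  (\rank (row_mx B C) <= \rank B + q)%N.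
Proof.
rewrite -mxrank_tr tr_row_mx -addsmxE.
apply: leq_trans (mxrank_adds_leqif _ _) _.
by rewrite mxrank_tr leq_add2l rank_leq_row.
Qed.

Lemma dim_obstruction : (0 < r)%N ->
  (k <= \sum_(i < r | 2 <= n i) (n i - 2)./2)%N ->
  ~ dim_le P (2 * k + #|[set i : 'I_r | 2 <= n i]|)%N.
Proof.
move=> r_gt0 /split_sum[kap [kap_le kap_sum]] dimP.
set rho := #|_| in dimP.
have [x0 [xs [Q0 Qs slack0 slacks]]] := exists_frame.
pose X : 'M[K]_(#|J|, e) := \matrix_t (xs t - x0).
(* A block of [(h i).*2.+1] vectors is bisected with at most [h i] positive ones, a face of
   dimension [(h i).-1]: this is [kap i] when [2 <= n i]. The bound on [kap i] makes the block fit
   into the [(n i).+1] vertices. *)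
pose h i := if (2 <= n i)%N then (kap i).+1 else 0%N.
have h_le i : ((h i).*2 <= n i)%N.
  rewrite /h; case: ifP => // n2; have := kap_le i n2; lia.
pose core i : {set 'I_N} := [set j : 'I_N | (j < (h i).*2.+1)%N].
have coreD i : core i \subset D i.
  by apply/subsetP => j; rewrite !inE ltnS => /leq_trans -> //.
have card_core i : #|core i| = (h i).*2.+1.
  rewrite -sum1_card (eq_bigl (fun j : 'I_N => (j < (h i).*2.+1)%N)); last first.
    by move=> j; rewrite inE.
  have le : ((h i).*2.+1 <= N)%N by apply: leq_trans (lt_Nmax n i); rewrite ltnS.
  by rewrite -(big_ord_widen N (fun=> 1%N) le) sum1_card card_ord.
(* Rates at the vertices outside the block are forced to be zero, except in segments, where the one
   remaining vertex does no harm. *)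
pose rest i := if (2 <= n i)%N then D i :\: core i else set0.
have card_rest i : #|rest i| = (if (2 <= n i) then n i - (h i).*2 else 0)%N.
  rewrite /rest; case: ifP => _; last by rewrite cards0.
  by rewrite cardsD (setIidPr (coreD i)) card_core card_simplex_vertices subSS.
pose Ex := [set p : pair | p.2 \in rest p.1].
have rhoE : rho = (\sum_(i < r | 2 <= n i) 1)%N.
  by rewrite sum1_card /rho; apply: eq_card => i; rewrite inE.
have card_Ex : (#|Ex| + 2 * k + 2 * rho = \sum_(i < r | 2 <= n i) n i)%N.
  rewrite card_dep_pairs -kap_sum rhoE !big_distrr /=.
  rewrite (eq_bigr (fun i => if (2 <= n i) then n i - (h i).*2 else 0)%N) //.
  rewrite -big_mkcond -!big_split /=; apply: eq_bigr => i n2.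
  by have := h_le i; rewrite /h n2; lia.
have card_J' : (#|J| + rho = \sum_(i < r | 2 <= n i) n i + r)%N.
  rewrite card_J (bigID (fun i => 2 <= n i)%N) /= -addnA; congr addn.
  rewrite (eq_bigr (fun=> 1%N)); last first.
    by move=> i; rewrite -ltnNge ltnS => n1; apply/eqP; rewrite eqn_leq n1 n_gt0.
  rewrite rhoE addnC -[RHS](card_ord r) -sum1_card.
  by rewrite [RHS](bigID (fun i => 2 <= n i)%N).
have rankXA : (\rank (X *m A) <= 2 * k + rho)%N.
  have -> : X *m A = \matrix_t (xs t *m A - x0 *m A).
    by apply/row_matrixP => t; rewrite row_mul !rowK mulmxBl.
  by apply: dim_le_rank dimP _ _ => [|t]; apply/PQ; [exists x0|exists (xs t)].
pose w f : 'cV[K]_#|J| := X *m (c (facet f))^T.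
pose Z : 'M[K]_(#|J|, #|Ex|) := \matrix_(t, q) w (enum_val q) t 0.
(* From [\sum_i n i] directions, the projection removes at most [2 * k + rho] and the rates at [Ex]
   at most [#|Ex|]; at least [r] dimensions remain, matching the [r] blocks. *)
have [U [U_free]] : exists U : 'M[K]_(r, #|J|), row_free U /\ U *m row_mx (X *m A) Z = 0.
  apply: exists_free_kernel; have := mxrank_row_mx_le (X *m A) Z.
  by move: (\rank (row_mx _ _)) (\rank _) rankXA card_Ex card_J' => *; lia.
rewrite mul_mx_row -row_mx0 => /eq_row_mx[UXA UZ].
have Uw f : f \in Ex -> U *m w f = 0.
  move=> fE; apply/colP => i; rewrite [RHS]mxE.
  have /matrixP/(_ i (enum_rank_in fE f)) := UZ; rewrite [RHS]mxE => <-.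
  rewrite !mxE; apply: eq_bigr => t _; congr (_ * _).
  by rewrite [Z _ _]mxE enum_rankK_in.
pose label := {p : pair | p.2 \in core p.1}.
pose col (l : label) := (val l).1.
have card_col i : #|[set l : label | col l == i]| = (h i).*2.+1.
  rewrite -card_core -(card_in_imset (f := fun l : label => (val l).2)).
    apply: eq_card => j; apply/imsetP/idP => [[l]|jc].
      by rewrite inE => /eqP <- ->; apply: (valP l).
    by exists (Sub (i, j) jc : label); rewrite ?inE /col ?SubK.
  move=> l l'; rewrite !inE /col => /eqP e1 /eqP e' e2; apply: val_inj.
  by rewrite [LHS]surjective_pairing [RHS]surjective_pairing e1 e' e2.
have [u [u0 Hu]] := @few_positive K r label (fun l => U *m w (val l)) col r_gt0
   ltac:(by move=> i; rewrite card_col /= odd_double).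
pose mu := u *m U.
have rate_mu f : rate x0 xs mu f = (u *m (U *m w f)) 0 0.
  by rewrite /rate dotvE /mu /w !mulmxA.
have muXA : mu *m (\matrix_t (xs t - x0)) *m A = 0.
  by rewrite -/X /mu -!mulmxA UXA mulmx0.
have core_pos i : (#|positive x0 xs mu i :&: core i| <= h i)%N.
  have := Hu i; rewrite card_col mul2n ltnS leq_double; apply: leq_trans.
  apply: leq_trans (leq_imset_card (fun l : label => (val l).2) _).
  apply: subset_leq_card; apply/subsetP => j; rewrite !inE rate_mu => /andP[/andP[_ pos] jc].
  have jc' : (i, j).2 \in core (i, j).1 by rewrite inE.
  by apply/imsetP; exists (Sub (i, j) jc' : label); rewrite ?inE /col ?SubK ?eqxx.
have pos_D i : positive x0 xs mu i \subset D i.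
  by apply/subsetP => j; rewrite inE => /andP[].
suff mu0 : mu = 0.
  case/eqP: u0; apply: (row_free_inj U_free); by rewrite mul0mx -/mu mu0.
apply: (kernel_trivial Q0 Qs slack0 slacks muXA).
(* For [2 <= n i], the positive set lies in the core and has at most [(kap i).+1] elements. For
   [n i = 1], it has at most one, and contributes nothing. *)
rewrite -kap_sum [X in (_ <= X)%N]big_mkcond; apply: leq_sum => i _.
have := cardsID (core i) (positive x0 xs mu i).
have := core_pos i; rewrite /h; case: ifP => n2.
  have -> : positive x0 xs mu i :\: core i = set0.
    apply/setP => j; rewrite !inE; apply/negP => /and3P[jc jD].
    have fE : (i, j) \in Ex by rewrite inE /= /rest n2 !inE jc.
    by rewrite rate_mu (Uw _ fE) mulmx0 mxE ltxx.
  by rewrite cards0; lia.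
have : (#|positive x0 xs mu i :\: core i| <= #|D i :\: core i|)%N.
  by apply/subset_leq_card/setSD/pos_D.
rewrite (cardsD (D i)) (setIidPr (coreD i)) card_core card_simplex_vertices /h n2.
by have := n_gt0 i; lia.
Qed.

End Obstruction.

Local Close Scope ring_scope.

(* delta_pr(k,n) >= 2k + |R| + 1: every (k,n)-PPSN polytope P has
   dimension > 2k + |R|, i.e. dimension is not <= 2k + |R|. *)
Theorem theorem4p6 (R : realFieldType) (r : nat) (n : 'I_r -> nat)
  (k d : nat) (P : 'rV[R]_d -> Prop) :
  (0 < r)%N -> (forall i, 0 < n i)%N ->
  (k <= \sum_(i < r | 2 <= n i) (n i - 2)./2)%N ->
  PPSN k n P ->
  ~ dim_le P (2 * k + #|[set i : 'I_r | 2 <= n i]|).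
Proof.
move=> r_gt0 n_gt0 k_le [[_ skel] [e [Q [A [polyQ combQ PQ]]]]].
have [c [b faces]] := comb_equiv_faces combQ.
apply: (dim_obstruction (c := c) (b := b) n_gt0 PQ) => //.
exact: preserved_face faces PQ skel.
Qed.
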